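(* Let $\nu$ be a charge on $\mathbb C$ satisfying the Blaschke condition near infinity for the upper half-plane $\mathbb C^{\rm up}$. Then the balayage $\nu^{\rm bal}$ of $\nu$ out of $\mathbb C^{\rm up}$ is defined (i.e. the integral defining it is finite for every bounded Borel set, so that $\nu^{\rm bal}$ is a charge on $\mathbb C$). Moreover, let $-\infty<t_1<t_2<+\infty$, $a\in(0,1)$, and put $$t_0:=\frac{t_1+t_2}{2},\qquad r:=\frac{t_2-t_1}{2},\qquad T:=\max\{|t_1|,|t_2|\},\qquad \nu^{\overline{\rm up}}:=\nu\big|_{\overline{\mathbb C}^{\rm up}}$$ (restriction of $\nu$ to the closed upper half-plane). Then $$\begin{aligned}|\nu^{\rm bal}|^{\mathbb R}(t_2)-|\nu^{\rm bal}|^{\mathbb R}(t_1)\le{}& |\nu^{\overline{\rm up}}|(t_0,r)+|\nu^{\overline{\rm up}}|(\{t_1,t_2\})+\frac{r(a+1/a)}{T}\,|\nu^{\overline{\rm up}}|\bigl(t_0,(a+1/a)T\bigr)\\&+\frac{2r}{\pi(1-a)^2}\int_{|z|\ge T}\Bigl|\operatorname{Im}\frac1z\Bigr|\,d|\nu^{\overline{\rm up}}|(z)+\frac{2r}{\pi}\int_r^{(a+1/a)T}\frac{|\nu^{\overline{\rm up}}|(t_0,t)}{t^2+r^2}\,dt.\end{aligned}$$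
   Context: $\mathbb C^{\rm up}=\{\operatorname{Im}z>0\}$, $\overline{\mathbb C}^{\rm up}=\{\operatorname{Im}z\ge0\}$, $\overline{\mathbb C}_{\rm low}=\{\operatorname{Im}z\le0\}$. A charge on $\mathbb C$ is a countably additive function of Borel subsets of $\mathbb C$ with values in $[-\infty,+\infty]$, finite on compact sets; $|\nu|$ is its total variation. For a charge or measure $\mu$ and $z\in\mathbb C$, $t\ge 0$: $\mu(z,t):=\mu(\overline D(z,t))$, where $\overline D(z,t)$ is the closed disc with centre $z$ and radius $t$. The distribution function of $\mu$ on $\mathbb R$ is $\mu^{\mathbb R}(t):=-\mu([t,0))$ for $t<0$ and $\mu^{\mathbb R}(t):=\mu([0,t])$ for $t\ge0$; $|\nu^{\rm bal}|^{\mathbb R}$ is the distribution function of the total variation $|\nu^{\rm bal}|$. $\nu$ satisfies the Blaschke condition near infinity for $\mathbb C^{\rm up}$ if for some $r_0>0$ one has $\int_{\mathbb C^{\rm up}\setminus D(0,r_0)}\operatorname{Im}\frac1{\bar z}\,d|\nu|(z)<+\infty$, where $D(0,r_0)$ is the open disc. Harmonic measure of the upper half-plane: $\omega(z,B)=\frac1\pi\int_{B\cap\mathbb R}\frac{\operatorname{Im}z}{(t-\operatorname{Re}z)^2+(\operatorname{Im}z)^2}\,dt$ for $z\in\mathbb C^{\rm up}$ and Borel $B$. The balayage of $\nu$ out of $\mathbb C^{\rm up}$ is $\nu^{\rm bal}(B):=\int_{\mathbb C^{\rm up}}\omega(z,B\cap\mathbb R)\,d\nu(z)+\nu(B\cap\overline{\mathbb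 C}_{\rm low})$ for Borel $B\subset\mathbb C$. *)

(* Defs.v *)
From HB Require Import structures.
From mathcomp Require Import all_boot all_order all_algebra.
From mathcomp Require Import all_classical all_reals all_analysis.
From mathcomp Require Import complex.

Set Implicit Arguments.
Unset Strict Implicit.
Unset Printing Implicit Defensive.

Import Order.TTheory GRing.Theory Num.Theory.
Import numFieldNormedType.Exports.

Local Open Scope classical_set_scope.
Local Open Scope complex_scope.
Local Open Scope ring_scope.

Local Notation Re := complex.Re.
Local Notation Im := complex.Im.

(* The topology of the complex numbers is the one of the modulus, and their
   measurable sets are the Borel sets of that topology. *)
HB.instance Definition _ (R : rcfType) :=
  PseudoPointedMetric.copy R[i] (R[i]^o).
HB.instance Definition _ (R : realType) :=
  Measurable.copy R[i] (g_sigma_algebraType (@open R[i])).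

Section Charges.
Variable R : realType.
Local Open Scope ereal_scope.
Implicit Types (nu mu : set R[i] -> \bar R) (A B D K : set R[i]).

(* In [\bar R] the sum of +oo and -oo is -oo; the third clause, the usual
   convention for signed measures, keeps this case from ever arising.
   Only the values of [nu] at Borel sets matter, here and below. *)
Definition is_charge nu : Prop :=
  [/\ nu set0 = 0,
      semi_sigma_additive nu,
      (forall A, measurable A -> nu A != +oo) \/
      (forall A, measurable A -> nu A != -oo) &
      forall K, compact K -> nu K \is a fin_num].

(* The Jordan decomposition nu = nu^+ - nu^-, |nu| = nu^+ + nu^-; the library
   has it for finite charges only. *)
Definition upper_variation nu A : \bar R :=
  ereal_sup [set nu B | B in [set B | measurable B /\ B `<=` A]].

Definition lower_variation nu A : \bar R :=
  upper_variation (fun B => - nu B) A.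

Definition charge_total_variation nu A : \bar R :=
  upper_variation nu A + lower_variation nu A.

(* For a nonnegative [f], this is a finite number iff both terms are finite,
   i.e., iff [f] is integrable with respect to |nu|. *)
Definition charge_integral nu D (f : R[i] -> \bar R) : \bar R :=
  \int[upper_variation nu]_(z in D) f z -
  \int[lower_variation nu]_(z in D) f z.

Definition charge_restr nu D : set R[i] -> \bar R := fun B => nu (B `&` D).

End Charges.

Section UpperHalfPlane.
Variable R : realType.
Implicit Types (nu mu : set R[i] -> \bar R) (B : set R[i]) (z c : R[i]).

Definition upper_half_plane : set R[i] := [set z | 0 < Im z].
Definition closed_upper_half_plane : set R[i] := [set z | 0 <= Im z].
Definition closed_lower_half_plane : set R[i] := [set z | Im z <= 0].

(* The norm of R[i] takes its (real) values in R[i]. *)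
Definition open_disc c (r : R) : set R[i] := [set z | `|z - c| < r%:C].
Definition closed_disc c (r : R) : set R[i] := [set z | `|z - c| <= r%:C].

Definition blaschke_near_infinity nu : Prop :=
  exists2 r0 : R, 0 < r0 &
    (\int[charge_total_variation nu]_(z in
         upper_half_plane `\` open_disc 0%R r0) (Im (z^*%C)^-1%R)%:E < +oo)%E.

(* The set of integration is the trace of [B] on the real axis. *)
Definition harmonic_measure z B : \bar R :=
  ((pi^-1)%:E *
   \int[@lebesgue_measure R]_(t in [set t : R | B t%:C])
     (Im z / ((t - Re z) ^+ 2 + Im z ^+ 2))%:E)%E.

Definition balayage nu B : \bar R :=
  (charge_integral nu upper_half_plane (fun z => harmonic_measure z B) +
   nu (B `&` closed_lower_half_plane))%E.

Definition distribution_function mu (t : R) : \bar R :=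
  if t < 0 then (- mu [set x%:C | x in `[t, 0%R[%classic])%E
  else mu [set x%:C | x in `[0, t]%classic].

End UpperHalfPlane.

Arguments upper_half_plane {R}.
Arguments closed_upper_half_plane {R}.
Arguments closed_lower_half_plane {R}.

(* Main.v *)
Require Import Defs.
From HB Require Import structures.
From mathcomp Require Import all_boot all_order all_algebra.
From mathcomp Require Import all_classical all_reals all_analysis.
From mathcomp Require Import complex.
From mathcomp Require Import measurable_realfun ring lra.

Set Implicit Arguments.
Unset Strict Implicit.
Unset Printing Implicit Defensive.

Import Order.TTheory GRing.Theory Num.Theory.
Import numFieldNormedType.Exports.

Local Open Scope classical_set_scope.
Local Open Scope complex_scope.
Local Open Scope ring_scope.

(* The balayage is the difference of the sweeps [\int omega(z, .) dnu^+ + nu^+]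
   and [\int omega(z, .) dnu^- + nu^-] of the two Jordan parts of nu, so |nu^bal|
   is at most the sweep of |nu|, and everything reduces to integrating a pointwise
   bound of the harmonic measure of the chord [t1, t2] over the upper half-plane.
   With s = |z - t0| and A = (a + 1/a) T there are three zones.
   - s <= r: the harmonic measure is at most 1.
   - r < s <= A: among the points at distance s from t0, the chord is seen under
     the largest angle from t0 + i s, so the harmonic measure is at most
     (2/pi) atan (r/s). This is (2/pi) atan (r/A) plus the integral over [s, A] of
     (2r/pi) / (t^2 + r^2); Tonelli turns the latter into the integral of
     |nu|(t0, t).
   - s > A: here |z - t| >= (1 - a) |z| on the chord, so the Poisson kernel is at
     most |Im (1/z)| / (1 - a)^2. *)

Local Notation Re := complex.Re.
Local Notation Im := complex.Im.

(** * Modulus, Borel sets and compact sets of the complex plane *)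

Section ComplexBorel.
Variable R : realType.
Implicit Types (z w : R[i]) (e r M : R) (B K : set R[i]).

(** A real-valued form of the norm, whose values in [R[i]] fit neither real inequalities nor
    measurability into the line. *)
Definition modulus z : R := Num.sqrt (Re z ^+ 2 + Im z ^+ 2).

Lemma normc_modulus z : `|z| = (modulus z)%:C.
Proof. exact: normc_def. Qed.

Lemma normc_le z r : (`|z| <= r%:C) = (modulus z <= r).
Proof. by rewrite normc_modulus lecR. Qed.

Lemma normc_lt z r : (`|z| < r%:C) = (modulus z < r).
Proof. by rewrite normc_modulus ltcR. Qed.

Lemma normc_ge z r : (r%:C <= `|z|) = (r <= modulus z).
Proof. by rewrite normc_modulus lecR. Qed.

Lemma modulus_ge0 z : 0 <= modulus z.
Proof. exact: sqrtr_ge0. Qed.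

Lemma sqr_modulus z : modulus z ^+ 2 = Re z ^+ 2 + Im z ^+ 2.
Proof. by rewrite sqr_sqrtr // addr_ge0 ?sqr_ge0. Qed.

Lemma ler_modulusD z w : modulus (z + w) <= modulus z + modulus w.
Proof. by rewrite -lecR rmorphD /= -!normc_modulus ler_normD. Qed.

Lemma modulus_real r : modulus r%:C = `|r|.
Proof. by rewrite /modulus /= expr0n addr0 sqrtr_sqr. Qed.

Lemma ler_modulusB z w : modulus z - modulus w <= modulus (z - w).
Proof. by rewrite lerBlDr (le_trans _ (ler_modulusD _ _)) // subrK. Qed.

Lemma ler_Re_modulus z : `|Re z| <= modulus z.
Proof. by rewrite -lecR -normc_modulus normc_ge_Re. Qed.

Lemma ler_Im_modulus z : `|Im z| <= modulus z.
Proof.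
rewrite -(@ler_pXn2r _ 2) ?nnegrE ?modulus_ge0 // sqr_modulus.
by rewrite real_normK ?num_real // lerDr sqr_ge0.
Qed.

Lemma modulus_leD z : modulus z <= `|Re z| + `|Im z|.
Proof.
rewrite -(@ler_pXn2r _ 2) ?nnegrE ?modulus_ge0 ?addr_ge0 // sqr_modulus.
rewrite sqrrD !real_normK ?num_real // -addrA lerD2l addrC lerDl.
by rewrite mulrn_wge0 // mulr_ge0.
Qed.

Lemma near_normc_lt z e : 0 < e -> \forall w \near z, modulus (z - w) < e.
Proof.
move=> e0; apply/(@nbhs_ballP R[i] R[i]); exists e%:C; rewrite /= ?ltcR //.
by move=> w; rewrite /ball /= -normc_lt.
Qed.

Lemma continuous_Re : continuous (@complex.Re R).
Proof.
move=> z; apply/(@cvgrPdist_lt _ _ _ (nbhs z) (nbhs_filter z)) => e e0.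
apply: (@filterS _ _ (nbhs_filter z) _ _ _ (near_normc_lt z e0)) => w.
rewrite (_ : Re z - Re w = Re (z - w)); last by case: (z) => ? ?; case: (w).
exact: le_lt_trans (ler_Re_modulus _).
Qed.

Lemma continuous_Im : continuous (@complex.Im R).
Proof.
move=> z; apply/(@cvgrPdist_lt _ _ _ (nbhs z) (nbhs_filter z)) => e e0.
apply: (@filterS _ _ (nbhs_filter z) _ _ _ (near_normc_lt z e0)) => w.
rewrite (_ : Im z - Im w = Im (z - w)); last by case: (z) => ? ?; case: (w).
exact: le_lt_trans (ler_Im_modulus _).
Qed.

Lemma continuous_Complex : continuous (fun x : R * R => x.1 +i* x.2).
Proof.
move=> [x y]; apply/cvg_ballP => e e0.
(* Radii of balls in [R[i]] are elements of [R[i]]; a positive one is real. *)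
have [k ke] : exists k, e = k%:C.
  by exists (Re e); rewrite RRe_real // gtr0_real.
move: e0; rewrite {e}ke ltcR => k0.
have k20 : 0 < k / 2 by rewrite divr_gt0.
have := @near_ball R (R * R)%type (x, y) (k / 2) k20.
apply: filterS => w [/= xw yw]; rewrite /ball /= normc_lt.
apply: le_lt_trans (modulus_leD _) _ => /=.
by rewrite (splitr k) ltrD.
Qed.

Lemma continuous_real_complex : continuous (fun x : R => x%:C).
Proof.
move=> x; apply/cvg_ballP => e e0.
have [k ke] : exists k, e = k%:C.
  by exists (Re e); rewrite RRe_real // gtr0_real.
move: e0; rewrite {e}ke ltcR => k0.
have := @near_ball R R x k k0; apply: filterS => w xw.
by rewrite /ball /= normc_lt -rmorphB modulus_real.
Qed.

Lemma open_measurable_complex B : open B -> measurable B.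
Proof. by move=> oB; apply: sub_sigma_algebra. Qed.

Lemma continuous_measurable_complex (f : R[i] -> R) :
  continuous f -> measurable_fun setT f.
Proof.
move=> cf; apply: (measurability _ (RGenOpens.measurableE R)).
move=> _ [_ [a [b ->] <-]]; rewrite setTI.
apply: open_measurable_complex; exact: open_comp.
Qed.

Lemma measurable_Re : measurable_fun setT (@complex.Re R).
Proof. apply: continuous_measurable_complex. exact: continuous_Re. Qed.

Lemma measurable_Im : measurable_fun setT (@complex.Im R).
Proof. apply: continuous_measurable_complex. exact: continuous_Im. Qed.

Lemma measurable_modulus : measurable_fun setT (modulus : R[i] -> R).
Proof.
have msqrt : measurable_fun setT (@Num.sqrt R).
  by apply: continuous_measurable_fun; exact: sqrt_continuous.
have h : measurable_fun setT (fun z : R[i] => Re z ^+ 2 + Im z ^+ 2).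
  apply: measurable_funD; apply: measurable_funX.
    exact: measurable_Re.
  exact: measurable_Im.
exact: (measurableT_comp msqrt h).
Qed.

Lemma measurable_real_trace B : measurable B ->
  measurable [set t : R | B t%:C].
Proof.
move=> mB; rewrite -[X in measurable X]setTI.
have : measurable_fun setT (fun t : R => t%:C); last exact.
apply: (measurability (@open R[i])); first by [].
move=> _ [U oU <-]; rewrite setTI; apply: open_measurable.
by apply: open_comp => // t _; exact: continuous_real_complex.
Qed.

Lemma measurable_real_image (A : set R) : measurable A ->
  measurable [set x%:C | x in A].
Proof.
move=> mA.
rewrite (_ : [set _ | _ in _] =
    (@complex.Re R @^-1` A) `&` (@complex.Im R @^-1` [set 0])); last first.
  apply/seteqP; split => [_ [x Ax <-] //|[x y] /= [Ax y0]].
  by exists x => //; rewrite y0.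
apply: measurableI; rewrite -[X in measurable X]setTI.
  exact: measurable_Re.
exact: measurable_Im.
Qed.

Lemma hausdorff_complex : hausdorff_space R[i].
Proof. exact: (@norm_hausdorff _ R[i]^o). Qed.

Lemma compact_measurable_complex K : compact K -> measurable K.
Proof.
move=> cK; rewrite -[K]setCK; apply: measurableC; apply: open_measurable_complex.
exact/closed_openC/(compact_closed hausdorff_complex).
Qed.

(** These discs serve throughout as the test for boundedness and as an exhaustion of the plane. *)
Definition centered_disc (M : R) : set R[i] := [set z | modulus z <= M].

Lemma measurable_centered_disc M : measurable (centered_disc M).
Proof.
rewrite -[X in measurable X]setTI.
have := measurable_modulus measurableT (measurable_itv `]-oo, M]).
by congr (measurable (_ `&` _)); apply/funext => z; rewrite /= in_itv.
Qed.

Lemma compact_bounded_complex K : compact K ->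
  exists M, K `<=` centered_disc M.
Proof.
move=> cK.
have cts (f : R[i] -> R) : continuous f -> compact (f @` K).
  by move=> cf; apply: continuous_compact => //; exact: continuous_subspaceT.
have bnd (f : R[i] -> R) : continuous f -> exists M, forall z, K z -> `|f z| <= M.
  move=> cf; have /compact_bounded [M [_ Mf]] := cts f cf.
  by exists (M + 1) => z Kz; apply: (Mf (M + 1)); [rewrite ltrDl|exists z].
have [M1 HM1] := bnd _ continuous_Re; have [M2 HM2] := bnd _ continuous_Im.
exists (M1 + M2) => z Kz; apply: le_trans (modulus_leD z) _.
by rewrite lerD ?HM1 ?HM2.
Qed.

(** The disc lies in the square of side [2 M], a continuous image of a product of two compact
    segments. *)
Lemma centered_disc_sub_compact M :
  exists2 K, compact K & centered_disc M `<=` K.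
Proof.
exists ((fun x : R * R => x.1 +i* x.2) @` (`[- M, M] `*` `[- M, M])).
  apply: continuous_compact; last first.
    by apply: compact_setX; exact: segment_compact.
  by apply: continuous_subspaceT; exact: continuous_Complex.
case=> x y xyM; exists (x, y) => //=; rewrite !in_itv /= -!ler_norml.
by split; apply: le_trans xyM; [exact: (ler_Re_modulus (x +i* y))|
  exact: (ler_Im_modulus (x +i* y))].
Qed.

Lemma bounded_set_centered_disc B : bounded_set (B : set R[i]^o) ->
  exists M, B `<=` centered_disc M.
Proof.
move=> [M0 [M0r HM]]; exists (Re M0 + 1) => z Bz; rewrite /centered_disc /=.
rewrite -normc_le; apply: HM => //; rewrite rmorphD /= RRe_real //.
by rewrite ltrDl ltr01.
Qed.

End ComplexBorel.

(** * Hahn and Jordan decompositions of a charge; its variations as measures *)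

Section ChargeVariation.
Variable R : realType.
Local Open Scope ereal_scope.
Implicit Types (nu : set R[i] -> \bar R) (A B D P : set R[i]).

Lemma charge_setU nu A B : is_charge nu -> measurable A -> measurable B ->
  A `&` B = set0 -> nu (A `|` B) = nu A + nu B.
Proof.
move=> [nu0 nuS _ _] mA mB AB.
have := semi_additiveW nu0 (semi_sigma_additive_is_additive nu0 nuS).
by apply => //; exact: measurableU.
Qed.

Lemma charge_setID nu A D : is_charge nu -> measurable A -> measurable D ->
  nu A = nu (A `&` D) + nu (A `\` D).
Proof.
move=> hnu mA mD; rewrite -charge_setU ?setUIDK //.
- exact: measurableI.
- exact: measurableD.
- by rewrite setDE setIACA setICr setI0.
Qed.

(** A finite sum in [\bar R] has finite summands; apply this to [A] split along [B]. *)
Lemma charge_fin_numS nu A B : is_charge nu -> measurable A -> measurable B ->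
  B `<=` A -> nu A \is a fin_num -> nu B \is a fin_num.
Proof.
move=> hnu mA mB /setIidPr BA; rewrite (charge_setID hnu mA mB) BA.
by rewrite fin_numD => /andP[].
Qed.

Lemma charge_fin_num_disc nu A M : is_charge nu -> measurable A ->
  A `<=` centered_disc M -> nu A \is a fin_num.
Proof.
move=> hnu mA AM; have [K cK MK] := centered_disc_sub_compact M.
apply: (charge_fin_numS hnu (compact_measurable_complex cK) mA).
  exact: subset_trans MK.
by have [_ _ _] := hnu; exact.
Qed.

Lemma charge_opp nu : is_charge nu -> is_charge (fun B => - nu B).
Proof.
move=> [nu0 nuS nuoo nuK]; split.
- by rewrite nu0 oppe0.
- move=> F mF tF mUF.
  rewrite [X in X @ _ --> _](_ : _ =
      fun n => - (\sum_(0 <= i < n) nu (F i))); last first.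
    (* Negation passes through an extended sum as long as no two terms are infinities of opposite
       sign; the third clause of [is_charge] guarantees this. *)
    apply/funext => n; rewrite sumeN // => i j _ _.
    by case: nuoo => h; have := h _ (mF i); have := h _ (mF j);
      case: (nu (F i)); case: (nu (F j)).
  by apply: cvgeN; exact: nuS.
- by case: nuoo => h; [right|left] => A mA; have := h _ mA; case: (nu A).
- by move=> K cK; rewrite fin_numN nuK.
Qed.

Lemma charge_restr_charge nu D : measurable D -> is_charge nu ->
  is_charge (charge_restr nu D).
Proof.
move=> mD hnu; have [nu0 nuS nuoo nuK] := hnu; split.
- by rewrite /charge_restr set0I.
- move=> F mF tF mUF; rewrite /charge_restr setI_bigcupl.
  apply: nuS => [i||]; first exact: measurableI.
    exact: trivIset_setIr.
  by rewrite -setI_bigcupl; exact: measurableI.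
- case: nuoo => h; [left|right] => A mA; apply: h; exact: measurableI.
- move=> K cK; have mK := compact_measurable_complex cK.
  apply: (charge_fin_numS hnu mK); [exact: measurableI|exact: subIsetl|].
  exact: nuK.
Qed.

Definition hahn_set nu P := [/\ measurable P,
  forall A, measurable A -> A `<=` P -> 0 <= nu A &
  forall A, measurable A -> A `<=` ~` P -> nu A <= 0].

Lemma hahn_setN nu P : hahn_set nu P -> hahn_set (fun B => - nu B) (~` P).
Proof.
move=> [mP Ppos Pneg]; split; first exact: measurableC.
  by move=> A mA AP; rewrite oppe_ge0 Pneg.
by move=> A mA; rewrite setCK => AP; rewrite oppe_le0 Ppos.
Qed.

(* The library decomposes finite charges only: glue the decompositions of the
   restrictions of [nu] to the annuli between consecutive discs. *)
Lemma exists_hahn_set nu : is_charge nu -> exists P, hahn_set nu P.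
Proof.
move=> hnu; pose E := seqDU (fun n => @centered_disc R n%:R).
have mE n : measurable (E n).
  apply: measurableD; first exact: measurable_centered_disc.
  by apply: bigsetU_measurable => k _; exact: measurable_centered_disc.
have tE : trivIset setT E := @trivIset_seqDU _ _.
have UE : \bigcup_n E n = setT.
  rewrite -seqDU_bigcup_eq; apply/seteqP; split => // z _.
  exists (Num.truncn (modulus z)).+1 => //=; apply/ltW.
  by rewrite /centered_disc /= truncnS_gt.
have ED n : E n `<=` centered_disc n%:R by exact: subDsetl.
have /choice[P HP] n : exists Pn, hahn_set (charge_restr nu (E n)) Pn.
  have [c0 cS _ _] := charge_restr_charge (mE n) hnu.
  have cfin A : measurable A -> charge_restr nu (E n) A \is a fin_num.
    move=> mA; apply: (charge_fin_num_disc (M := n%:R) hnu).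
      exact: measurableI.
    by apply: subset_trans (ED n); exact: subIsetr.
  pose c : {charge set R[i] -> \bar R} :=
    HB.pack (charge_restr nu (E n)) (isCharge.Build _ _ _ _ c0 cfin cS).
  have [Q [N [[mQ Qpos] [mN Nneg] QN _]]] := Hahn_decomposition c.
  exists Q; split => // A mA AQ; apply: Nneg => // z Az.
  by have : (Q `|` N) z; [rewrite QN|case => // /(AQ z Az)].
pose Q := \bigcup_n (P n `&` E n).
have mQ : measurable Q.
  apply: bigcupT_measurable => n; apply: measurableI => //.
  by have [] := HP n.
have series A : measurable A ->
    \sum_(0 <= i < n) nu (A `&` E i) @[n --> \oo] --> nu A.
  move=> mA; have [_ nuS _ _] := hnu.
  have {2}-> : A = \bigcup_n (A `&` E n) by rewrite -setI_bigcupr UE setIT.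
  apply: nuS => [i||]; first exact: measurableI.
    exact: trivIset_setIl.
  by rewrite -setI_bigcupr UE setIT.
(* On each annulus [Q] agrees with [P n], so every term [nu (A]&[E i)] has the required sign, and so
   does the limit of the partial sums. *)
exists Q; split => // A mA AQ.
- have AE n : A `&` E n `<=` P n.
    move=> z [Az Enz]; have [k _ [Pkz Ekz]] := AQ z Az.
    by have -> : n = k by apply: tE => //; exists z.
  apply: cvge_ge (series A mA); apply: nearW => n.
  apply: sume_ge0 => i _; have [_ Ppos _] := HP i.
  have := Ppos (A `&` E i); rewrite /charge_restr -setIA setIid; apply => //.
  exact: measurableI.
- have AE n : A `&` E n `<=` ~` P n.
    by move=> z [Az Enz] Pnz; apply: (AQ z Az); exists n.
  apply: cvge_le (series A mA); apply: nearW => n.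
  apply: sume_le0 => i _; have [_ _ Pneg] := HP i.
  have := Pneg (A `&` E i); rewrite /charge_restr -setIA setIid; apply => //.
  exact: measurableI.
Qed.

(** The supremum is attained at [A]&[P]: from a competitor [B], removing [B]\[P] cannot decrease the
    value, and neither can enlarging [B]&[P] to [A]&[P]. *)
Lemma upper_variationE nu P A : is_charge nu -> hahn_set nu P ->
  measurable A -> upper_variation nu A = nu (A `&` P).
Proof.
move=> hnu [mP Ppos Pneg] mA; apply/eqP; rewrite eq_le; apply/andP; split.
  apply: ge_ereal_sup => _ [B [mB BA] <-].
  rewrite (charge_setID hnu mB mP) -[leRHS]adde0.
  have mAP : measurable (A `&` P) by exact: measurableI.
  have mBP : measurable (B `&` P) by exact: measurableI.
  apply: leeD.
    rewrite [leRHS](charge_setID hnu mAP mBP).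
    rewrite (_ : A `&` P `&` (B `&` P) = B `&` P); last first.
      by apply/setIidPr; exact: setSI.
    by rewrite leeDl // Ppos //; [exact: measurableD|move=> z [[]]].
  by apply: Pneg; [exact: measurableD|exact: subDsetr].
apply: ereal_sup_ubound; exists (A `&` P) => //.
by split; [exact: measurableI|exact: subIsetl].
Qed.

Lemma lower_variationE nu P A : is_charge nu -> hahn_set nu P ->
  measurable A -> lower_variation nu A = - nu (A `\` P).
Proof.
move=> hnu hP mA; rewrite /lower_variation setDE.
exact: (upper_variationE (charge_opp hnu) (hahn_setN hP)).
Qed.

Lemma upper_variation0 nu : is_charge nu -> upper_variation nu set0 = 0.
Proof.
move=> hnu; have [P hP] := exists_hahn_set hnu.
by rewrite (upper_variationE hnu hP) // set0I; have [] := hnu.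
Qed.

Lemma upper_variation_ge0 nu A : is_charge nu -> 0 <= upper_variation nu A.
Proof.
move=> [nu0 _ _ _]; apply: ereal_sup_ubound; exists set0 => //.
by split => //; exact: sub0set.
Qed.

Lemma upper_variation_sigma_additive nu : is_charge nu ->
  semi_sigma_additive (upper_variation nu).
Proof.
move=> hnu F mF tF mUF; have [P hP] := exists_hahn_set hnu.
have mP : measurable P by case: hP.
under eq_fun do under eq_bigr do rewrite (upper_variationE hnu hP) //.
rewrite (upper_variationE hnu hP) // setI_bigcupl.
have [_ nuS _ _] := hnu; apply: nuS => [i||]; first exact: measurableI.
  exact: trivIset_setIr.
by rewrite -setI_bigcupl; exact: measurableI.
Qed.

Lemma charge_jordan nu A : is_charge nu -> measurable A ->
  nu A = upper_variation nu A - lower_variation nu A.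
Proof.
move=> hnu mA; have [P hP] := exists_hahn_set hnu.
have mP : measurable P by case: hP.
rewrite (upper_variationE hnu hP) // (lower_variationE hnu hP) // oppeK.
exact: charge_setID.
Qed.

(** By the Hahn decomposition the upper variation is itself a value of [nu]. *)
Lemma upper_variation_ltoo nu A : is_charge nu ->
  (forall B, measurable B -> nu B != +oo) -> measurable A ->
  upper_variation nu A < +oo.
Proof.
move=> hnu nuoo mA; have [P hP] := exists_hahn_set hnu.
have mP : measurable P by case: hP.
rewrite (upper_variationE hnu hP) // ltey; apply: nuoo; exact: measurableI.
Qed.

Lemma lower_variation_ltoo nu A : is_charge nu ->
  (forall B, measurable B -> nu B != -oo) -> measurable A ->
  lower_variation nu A < +oo.
Proof.
move=> hnu nuoo; apply: upper_variation_ltoo; first exact: charge_opp.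
by move=> B mB; have := nuoo B mB; case: (nu B).
Qed.

Lemma upper_variation_disc_ltoo nu A M : is_charge nu -> measurable A ->
  A `<=` centered_disc M -> upper_variation nu A < +oo.
Proof.
move=> hnu mA AM; have [P hP] := exists_hahn_set hnu.
have mP : measurable P by case: hP.
rewrite (upper_variationE hnu hP) // ltey_eq (charge_fin_num_disc (M := M)) //.
  exact: measurableI.
by apply: subset_trans AM; exact: subIsetl.
Qed.

Lemma upper_variation_restr nu D A : measurable D ->
  upper_variation (charge_restr nu D) A = upper_variation nu (A `&` D).
Proof.
move=> mD; congr ereal_sup; apply/seteqP; split => _ [B [mB BA] <-].
  by exists (B `&` D) => //; split; [exact: measurableI|exact: setSI].
exists B; first by split => // z /BA[].
by rewrite /charge_restr setIidl // => z /BA[].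
Qed.

Lemma charge_total_variation_restr nu D A : measurable D ->
  charge_total_variation (charge_restr nu D) A =
  charge_total_variation nu (A `&` D).
Proof.
by move=> mD; rewrite /charge_total_variation /lower_variation
  -!upper_variation_restr.
Qed.

(** The proof that [nu] is a charge is an argument, so that a measure structure can be attached to
    the name. *)
Definition upper_measure nu of is_charge nu := upper_variation nu.

Section UpperMeasure.
Variables (nu : set R[i] -> \bar R) (hnu : is_charge nu).

Let upper0 : upper_measure hnu set0 = 0.
Proof. exact: upper_variation0. Qed.

Let upper_ge0 A : 0 <= upper_measure hnu A.
Proof. exact: upper_variation_ge0. Qed.

Let upperS : semi_sigma_additive (upper_measure hnu).
Proof. exact: upper_variation_sigma_additive. Qed.

HB.instance Definition _ := isMeasure.Build _ R[i] R (upper_measure hnu)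
  upper0 upper_ge0 upperS.

End UpperMeasure.

Definition lower_measure nu (hnu : is_charge nu) :
  {measure set R[i] -> \bar R} := upper_measure (charge_opp hnu).

Definition variation_measure nu of is_charge nu := charge_total_variation nu.

Section VariationMeasure.
Variables (nu : set R[i] -> \bar R) (hnu : is_charge nu).

Lemma variation_measureE :
  variation_measure hnu = measure_add (upper_measure hnu) (lower_measure hnu).
Proof. by apply/funext => A; rewrite measure_addE. Qed.

Let variation0 : variation_measure hnu set0 = 0.
Proof. rewrite variation_measureE; exact: measure0. Qed.

Let variation_ge0 A : 0 <= variation_measure hnu A.
Proof. rewrite variation_measureE; exact: measure_ge0. Qed.

Let variationS : semi_sigma_additive (variation_measure hnu).
Proof. rewrite variation_measureE; exact: measure_semi_sigma_additive. Qed.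

HB.instance Definition _ := isMeasure.Build _ R[i] R (variation_measure hnu)
  variation0 variation_ge0 variationS.

Lemma variation_measure_disc_ltoo A M : measurable A ->
  A `<=` centered_disc M -> variation_measure hnu A < +oo.
Proof.
move=> mA AM; apply: lte_add_pinfty.
  exact: upper_variation_disc_ltoo AM.
exact: (upper_variation_disc_ltoo (charge_opp hnu)) AM.
Qed.

(** The discs of integer radius exhaust the plane and have finite variation. Sigma-finiteness is
    what Tonelli's theorem asks for in [integral_layer]. *)
Let variation_sigma_finite : sigma_finite setT (variation_measure hnu).
Proof.
exists (fun n => centered_disc n%:R).
  apply/seteqP; split => // z _.
  exists (Num.truncn (modulus z)).+1 => //=; apply/ltW.
  by rewrite /centered_disc /= truncnS_gt.
move=> n; have mn := @measurable_centered_disc R n%:R.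
split => //. apply: (variation_measure_disc_ltoo mn (@subset_refl _ _)).
Qed.

HB.instance Definition _ := Measure_isSigmaFinite.Build _ R[i] R
  (variation_measure hnu) variation_sigma_finite.

Lemma ge0_integral_variation D (f : R[i] -> \bar R) : measurable D ->
  (forall z, D z -> 0 <= f z) -> measurable_fun D f ->
  \int[charge_total_variation nu]_(z in D) f z =
  \int[upper_variation nu]_(z in D) f z +
  \int[lower_variation nu]_(z in D) f z.
Proof.
move=> mD f0 mf; rewrite -[charge_total_variation nu]/(variation_measure hnu).
by rewrite variation_measureE ge0_integral_measure_add.
Qed.

End VariationMeasure.

End ChargeVariation.

(** * Arctangents as integrals of the Poisson kernel, and viewing angles of a chord *)

Section Arctangent.
Variable R : realType.
Implicit Types (x y r s u c d p q : R).

Lemma FTC2_is_derive (F f : R -> R) c d : c < d ->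
  (forall t : R, is_derive t 1 F (f t)) -> continuous f ->
  (\int[lebesgue_measure]_(t in `[c, d]) (f t)%:E = (F d - F c)%:E)%E.
Proof.
move=> cd Ff cf; have dF t : derivable F t 1 by apply: ex_derive.
have cF : continuous F.
  by move=> t; apply: differentiable_continuous; exact/derivable1_diffP.
rewrite EFinB; apply: continuous_FTC2 => //.
- exact: continuous_subspaceT.
- split => [t _||]; first exact: dF.
  + exact/cvg_at_right_filter/cF.
  + exact/cvg_at_left_filter/cF.
- by move=> t _; rewrite derive1E; apply: derive_val.
Qed.

Lemma is_derive_atan_affine (x y t : R) : 0 < y ->
  is_derive t 1 (fun t : R => atan ((t - x) / y)) (y / ((t - x) ^+ 2 + y ^+ 2)).
Proof.
move=> y0.
have h1 : is_derive t 1 (fun t : R => (t - x) / y) y^-1.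
  have -> : (fun t : R => (t - x) / y) = (y^-1 \*: (id \- cst x))%R.
    by apply/funext => v; rewrite /= /GRing.scale /= mulrC.
  by apply: is_derive_eq; rewrite /= subr0 /GRing.scale /= mulr1.
have h2 := is_derive1_atan ((t - x) / y).
have h3 := @is_derive1_comp _ atan (fun t : R => (t - x) / y) t _ _ h2 h1.
apply: (is_derive_eq h3).
by field; rewrite !gt_eqF // ltr_wpDl ?sqr_ge0 ?exprn_gt0.
Qed.

Lemma continuous_poisson x y : 0 < y ->
  continuous (fun t : R => y / ((t - x) ^+ 2 + y ^+ 2)).
Proof.
move=> y0 t; apply: cvgM; first exact: cvg_cst.
apply: cvgV.
  by rewrite gt_eqF // ltr_wpDl ?sqr_ge0 ?exprn_gt0.
apply: cvgD; last exact: cvg_cst.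
apply: (@continuous_comp _ _ _ (fun t : R => t - x) (fun v => v ^+ 2)).
  by apply: cvgB; [exact: cvg_id|exact: cvg_cst].
exact: exprn_continuous.
Qed.

Lemma integral_poisson x y c d : 0 < y -> c < d ->
  (\int[lebesgue_measure]_(t in `[c, d]) (y / ((t - x) ^+ 2 + y ^+ 2))%:E =
   (atan ((d - x) / y) - atan ((c - x) / y))%:E)%E.
Proof.
move=> y0 cd.
apply: (FTC2_is_derive (F := fun t : R => atan ((t - x) / y))) => //.
  by move=> t; exact: is_derive_atan_affine.
exact: continuous_poisson.
Qed.

(** The difference of arctangents is the integral of the Poisson kernel over [c, d], where the
    kernel is at most [q]. *)
Lemma atanB_le x y c d q : 0 < y -> c < d ->
  (forall t, c <= t <= d -> y / ((t - x) ^+ 2 + y ^+ 2) <= q) ->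
  atan ((d - x) / y) - atan ((c - x) / y) <= (d - c) * q.
Proof.
move=> y0 cd hq; rewrite -lee_fin -integral_poisson //.
have p0 t : 0 <= y / ((t - x) ^+ 2 + y ^+ 2).
  by rewrite divr_ge0 ?addr_ge0 ?sqr_ge0 // ltW.
apply: (@le_trans _ _ (\int[lebesgue_measure]_(t in `[c, d]) (cst q%:E t))%E).
  apply: ge0_le_integral => //.
  - by move=> t _; rewrite lee_fin.
  - apply/measurable_EFinP; apply: measurable_funTS.
    by apply: continuous_measurable_fun; exact: continuous_poisson.
rewrite integral_cst //= lebesgue_measure_itv /= lte_fin cd.
by rewrite -EFinB -EFinM mulrC.
Qed.

(** The kernel at [x = 0], [y = 1] is 1 / (t^2 + 1), at most 1. *)
Lemma atan_le p : 0 < p -> atan p <= p.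
Proof.
move=> p0; have := @atanB_le 0 1 0 p 1 ltr01 p0.
rewrite !subr0 !divr1 atan0 subr0 mulr1; apply=> t _.
by rewrite ler_pdivrMr ?mul1r ?expr1n ?lerDr ?sqr_ge0 // ltr_wpDl ?sqr_ge0.
Qed.

Lemma cos_atan_gt0 p : 0 < cos (atan p).
Proof. by rewrite cos_atan invr_gt0 sqrtr_gt0 ltr_pwDl // sqr_ge0. Qed.

Lemma sin_atan p : sin (atan p) = p * cos (atan p).
Proof.
by rewrite -{2}(atanK p) /tan divfK // gt_eqF // cos_atan_gt0.
Qed.

(** Both sides lie in [0, pi], where the cosine is injective, and both cosines vanish. *)
Lemma atanDV p : 0 < p -> atan p + atan p^-1 = pi / 2.
Proof.
move=> p0; have q0 : 0 < p^-1 by rewrite invr_gt0.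
have a0 (v : R) : 0 < v -> 0 < atan v by move=> v0; rewrite -atan0 lt_atan.
have := a0 p p0; have := a0 p^-1 q0; have := atan_ltpi2 p; have := atan_ltpi2 p^-1.
have pi0 := pi_gt0 R; move=> h1 h2 h3 h4.
apply: (@cos_inj R).
- by rewrite in_itv /=; lra.
- by rewrite in_itv /=; lra.
rewrite cos_pihalf cosD !sin_atan mulrACA divff ?gt_eqF // mul1r.
by rewrite subrr.
Qed.

(** The left side is the angle under which [-r, r] is seen from u + i y. Outside the disc of radius
    [r] it is below pi/2, so the addition formula for the tangent determines it. *)
Lemma atanD_chord y r u : 0 < y -> 0 < r -> r ^+ 2 < u ^+ 2 + y ^+ 2 ->
  atan ((r - u) / y) + atan ((r + u) / y) =
  atan (2 * r * y / (u ^+ 2 + y ^+ 2 - r ^+ 2)).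
Proof.
move=> y0 r0 h; set p := (r - u) / y; set q := (r + u) / y.
have pq : p * q < 1.
  rewrite /p /q mulrACA -invfM ltr_pdivrMr ?mulr_gt0 // mul1r.
  by rewrite -subr_gt0; move: h; rewrite -subr_gt0; congr (0 < _); ring.
have cpq : 0 < cos (atan p + atan q).
  rewrite cosD !sin_atan mulrACA.
  rewrite (_ : _ - _ = (1 - p * q) * (cos (atan p) * cos (atan q))); last ring.
  by rewrite !mulr_gt0 ?subr_gt0 ?cos_atan_gt0.
have pi0 := pi_gt0 R.
have sum0 : 0 < atan p + atan q.
  rewrite -ltrBlDr sub0r -atanN lt_atan // /p /q -mulNr ltr_pM2r ?invr_gt0 //.
  by lra.
(* The sum lies in [0, pi], where the cosine decreases; its positive cosine puts it below pi/2. *)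
have sumpi : atan p + atan q < pi / 2.
  have := atan_ltpi2 p; have := atan_ltpi2 q => h1 h2.
  rewrite -ltr_cos ?cos_pihalf // in_itv /=; lra.
apply/esym; rewrite -[RHS]tanK; last first.
  by rewrite in_itv /=; lra.
congr atan; rewrite tanD ?gt_eqF ?cos_atan_gt0 // !atanK /p /q.
field; rewrite (gt_eqF y0) /= gt_eqF //.
by move: h; rewrite -subr_gt0; congr (0 < _); ring.
Qed.

(** With [s] fixed, the tangent 2 r y / (s^2 - r^2) of the viewing angle grows with [y <= s]. At
    [y = s] the point is i s, and the angle is twice atan (r / s). *)
Lemma atan_chord_le y r u s : 0 < y -> 0 < r -> 0 <= s -> r < s ->
  s ^+ 2 = u ^+ 2 + y ^+ 2 ->
  atan ((r - u) / y) + atan ((r + u) / y) <= 2 * atan (r / s).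
Proof.
move=> y0 r0 s0 rs su.
have ys : y <= s.
  by rewrite -(@ler_pXn2r _ 2) ?nnegrE ?(ltW y0) // su lerDr sqr_ge0.
have rs2 : r ^+ 2 < s ^+ 2 by rewrite ltr_pXn2r // ?nnegrE ?ltW.
rewrite atanD_chord -?su //.
have -> : 2 * atan (r / s) = atan (r / s) + atan (r / s) by ring.
have := @atanD_chord s r 0; rewrite expr0n add0r subr0 addr0 => -> //; last first.
  exact: lt_trans rs.
apply: le_atan; rewrite ler_pM2r ?invr_gt0 ?subr_gt0 // ler_pM2l //.
by rewrite mulr_gt0.
Qed.

End Arctangent.

(** * Harmonic measure of the upper half-plane: bounds and measurability *)

Section HarmonicMeasure.
Variable R : realType.
Implicit Types (z : R[i]) (A B : set R[i]) (c d t M : R).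

(** The Poisson kernel without its factor 1/pi, which [harmonic_measure] keeps in front of the
    integral. *)
Definition poisson z t : R := Im z / ((t - Re z) ^+ 2 + Im z ^+ 2).

Lemma poisson_ge0 z t : 0 <= Im z -> 0 <= poisson z t.
Proof. by move=> y0; rewrite divr_ge0 // addr_ge0 // sqr_ge0. Qed.

Lemma measurable_poisson z D : 0 < Im z -> measurable_fun D (poisson z).
Proof.
move=> y0; apply: measurable_funTS; apply: continuous_measurable_fun.
exact: continuous_poisson.
Qed.

Lemma trace_real_image (S : set R) :
  [set t : R | [set x%:C | x in S] t%:C] = S.
Proof. by apply/seteqP; split => [t [x Sx [<-]] //|t St]; exists t. Qed.

Lemma harmonic_measure_ge0 z B : 0 < Im z -> (0 <= harmonic_measure z B)%E.
Proof.
move=> y0; rewrite mule_ge0 ?lee_fin ?invr_ge0 ?pi_ge0 // integral_ge0 // => t _.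
by rewrite lee_fin; apply: poisson_ge0; apply: ltW.
Qed.

Lemma harmonic_measureS z A B : 0 < Im z -> measurable A -> measurable B ->
  A `<=` B -> (harmonic_measure z A <= harmonic_measure z B)%E.
Proof.
move=> y0 mA mB AB; apply: lee_wpmul2l; first by rewrite lee_fin invr_ge0 pi_ge0.
apply: ge0_subset_integral => //.
- exact: measurable_real_trace.
- exact: measurable_real_trace.
- by apply/measurable_EFinP; exact: measurable_poisson.
- by move=> t _; rewrite lee_fin; apply: poisson_ge0; apply: ltW.
- by move=> t /AB.
Qed.

Lemma harmonic_measure_bigcup z (F : (set R[i])^nat) : 0 < Im z ->
  (forall n, measurable (F n)) -> trivIset setT F ->
  harmonic_measure z (\bigcup_n F n) =
  (\sum_(n <oo) harmonic_measure z (F n))%E.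
Proof.
move=> y0 mF tF; rewrite /harmonic_measure nneseriesZl; last first.
  move=> n _; apply: integral_ge0 => t _; rewrite lee_fin.
  by apply: poisson_ge0; apply: ltW.
congr (_ * _)%E.
rewrite (_ : [set t | _] = \bigcup_n [set t : R | F n t%:C]); last first.
  by apply/seteqP; split.
rewrite ge0_integral_bigcup //.
- by move=> n; exact: measurable_real_trace.
- by apply/measurable_EFinP; exact: measurable_poisson.
- by move=> t _; rewrite lee_fin; apply: poisson_ge0; apply: ltW.
- move=> m n _ _ [t [Fmt Fnt]]; apply: tF => //; by exists t%:C.
Qed.

Lemma harmonic_measure_itv z c d : 0 < Im z -> c < d ->
  harmonic_measure z [set x%:C | x in `[c, d]] =
  (pi^-1 * (atan ((d - Re z) / Im z) - atan ((c - Re z) / Im z)))%:E.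
Proof.
move=> y0 cd; rewrite /harmonic_measure trace_real_image.
by rewrite integral_poisson.
Qed.

(** By monotonicity the whole line suffices. On each interval of an exhaustion the integral is a
    difference of two arctangents, hence below pi, and monotone convergence carries the bound to the
    limit. *)
Lemma harmonic_measure_le1 z B : 0 < Im z -> measurable B ->
  (harmonic_measure z B <= 1)%E.
Proof.
move=> y0 mB.
apply: (@le_trans _ _ (harmonic_measure z setT)).
  by apply: harmonic_measureS.
have pV : (1 = pi^-1%:E * (@pi R)%:E)%E.
  by rewrite -EFinM mulVf // gt_eqF // pi_gt0.
rewrite pV; apply: lee_wpmul2l; first by rewrite lee_fin invr_ge0 pi_ge0.
(* The shift to [n.+1] keeps the interval nondegenerate at [n = 0], as [integral_poisson]
   requires. *)
pose F n : set R := `[- (n.+1%:R : R), n.+1%:R]%classic.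
have -> : [set t : R | setT t%:C] = \bigcup_n F n.
  apply/seteqP; split => // t _; exists (Num.truncn `|t|) => //.
  by rewrite /F /= in_itv /= -ler_norml ltW // truncnS_gt.
have := @ge0_nondecreasing_set_cvg_integral _ (measurableTypeR R) R F
  (fun t => (poisson z t)%:E) (@lebesgue_measure R).
move=> cvgF; apply: (cvge_le _ (cvgF _ _ _ _)).
- apply: nearW => n; rewrite integral_poisson //; last first.
    by rewrite ltrNl; apply: lt_trans (_ : 0 < _); rewrite ?oppr_lt0.
  rewrite lee_fin.
  have := atan_ltpi2 ((n.+1%:R - Re z) / Im z).
  have := atan_gtNpi2 ((- n.+1%:R - Re z) / Im z).
  by lra.
- move=> m n mn; apply/subsetPset => t; rewrite /F /= !in_itv /= -!ler_norml.
  by move=> /le_trans; apply; rewrite ler_nat.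
- by move=> n; exact: measurable_itv.
- by move=> n; apply/measurable_EFinP; exact: measurable_poisson.
- by move=> n t _; rewrite lee_fin; apply: poisson_ge0; apply: ltW.
Qed.

Lemma harmonic_measure_itv_le z c d q : 0 < Im z -> c < d ->
  (forall t, c <= t <= d -> poisson z t <= q) ->
  (harmonic_measure z [set x%:C | x in `[c, d]] <= (pi^-1 * ((d - c) * q))%:E)%E.
Proof.
move=> y0 cd hq; rewrite harmonic_measure_itv // lee_fin.
by rewrite ler_pM2l ?invr_gt0 ?pi_gt0 //; exact: atanB_le.
Qed.

Lemma measurable_upper_half_plane : measurable (@upper_half_plane R).
Proof.
rewrite -[X in measurable X]setTI.
have := @measurable_Im R measurableT _ (measurable_itv `]0, +oo[).
by congr (measurable (_ `&` _)); apply/funext => z; rewrite /= in_itv /= andbT.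
Qed.

Lemma measurable_closed_upper_half_plane :
  measurable (@closed_upper_half_plane R).
Proof.
rewrite -[X in measurable X]setTI.
have := @measurable_Im R measurableT _ (measurable_itv `[0, +oo[).
by congr (measurable (_ `&` _)); apply/funext => z; rewrite /= in_itv /= andbT.
Qed.

Lemma measurable_closed_lower_half_plane :
  measurable (@closed_lower_half_plane R).
Proof.
rewrite -[X in measurable X]setTI.
have := @measurable_Im R measurableT _ (measurable_itv `]-oo, 0]).
by congr (measurable (_ `&` _)); apply/funext => z; rewrite /= in_itv.
Qed.

(** Inversion is continuous off 0, and the single point 0 is treated apart. *)
Lemma measurable_invr : measurable_fun setT (@GRing.inv R).
Proof.
rewrite -(setvU [set (0 : R)]); apply/measurable_funU => //.
  exact: measurableC.
split; last exact: measurable_fun_set1.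
apply: open_continuous_measurable_fun.
  by apply: closed_openC; exact: closed_eq.
by move=> x /set_mem /eqP x0; apply: inv_continuous.
Qed.

(* Cutting off the negative part of [Im z] makes the Poisson kernel
   nonnegative on the whole plane, as Tonelli's theorem requires. *)
Definition poisson_trace B (p : R[i] * R) : R :=
  Num.max (Im p.1) 0 / ((p.2 - Re p.1) ^+ 2 + Im p.1 ^+ 2) *
  \1_[set t : R | B t%:C] p.2.

Lemma measurable_poisson_trace B : measurable B ->
  measurable_fun setT (poisson_trace B).
Proof.
move=> mB.
have mI : measurable_fun setT (fun p : R[i] * R => Im p.1).
  exact: (measurableT_comp (@measurable_Im R) measurable_fst).
have mR : measurable_fun setT (fun p : R[i] * R => Re p.1).
  exact: (measurableT_comp (@measurable_Re R) measurable_fst).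
have m1 : measurable_fun setT (\1_[set t : R | B t%:C] : R -> R).
  by apply: measurable_indic; exact: measurable_real_trace.
apply: measurable_funM; last exact: (measurableT_comp m1 measurable_snd).
apply: measurable_funM; first by apply: measurable_maxr.
apply: (measurableT_comp measurable_invr).
apply: measurable_funD; apply: measurable_funX => //.
by apply: measurable_funB => //; exact: measurable_snd.
Qed.

(** By Tonelli the integral of [poisson_trace] over the second variable is measurable in the first.
    On the upper half-plane it is pi times the harmonic measure. *)
Lemma measurable_harmonic_measure B : measurable B ->
  measurable_fun upper_half_plane (fun z => harmonic_measure z B).
Proof.
move=> mB.
have p0 (p : R[i] * R) : (0 <= (poisson_trace B p)%:E)%E.
  rewrite lee_fin mulr_ge0 // divr_ge0 ?addr_ge0 ?sqr_ge0 //.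
  by rewrite le_max lexx orbT.
have mf := @measurable_fun_fubini_tonelli_F _ _ R[i] (measurableTypeR R) R
  (@lebesgue_measure R) (fun p => (poisson_trace B p)%:E)
  ((measurable_EFinP _ _).2 (measurable_poisson_trace mB)) p0.
apply: measurable_funeM.
apply: (eq_measurable_fun (fubini_F (@lebesgue_measure R)
  (fun p => (poisson_trace B p)%:E))); last exact: measurable_funTS.
move=> z /set_mem; rewrite /upper_half_plane /= => y0.
rewrite /fubini_F [RHS]integral_mkcond; apply: eq_integral => t _.
rewrite /poisson_trace /= patchE indicE; case: ifPn => tB /=.
  by rewrite mulr1 max_l // ltW.
by rewrite mulr0.
Qed.

Lemma Im_inv z : Im z^-1 = - (Im z / modulus z ^+ 2).
Proof. by rewrite sqr_modulus; case: z. Qed.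

Lemma Im_inv_conj z : Im (z^*%C)^-1 = Im z / modulus z ^+ 2.
Proof. by rewrite Im_inv !sqr_modulus; case: z => x y /=; rewrite sqrrN mulNr opprK. Qed.

(** The kernel is Im z / |z - t|^2, and Im (1 / conj z) is Im z / |z|^2. The bound serves with
    [b = 1/2] for the finiteness of the sweep and with [b = 1 - a] in the far zone. *)
Lemma poisson_le z t b : 0 < Im z -> 0 < b -> b * modulus z <= modulus (z - t%:C) ->
  poisson z t <= b ^- 2 * Im (z^*%C)^-1.
Proof.
move=> y0 b0 h.
have m0 : 0 < modulus z.
  by apply: lt_le_trans (ler_Im_modulus z); rewrite normr_gt0 gt_eqF.
rewrite Im_inv_conj /poisson.
have -> : (t - Re z) ^+ 2 + Im z ^+ 2 = modulus (z - t%:C) ^+ 2.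
  by rewrite sqr_modulus; case: (z) => x y /=; rewrite subr0; congr (_ + _); ring.
rewrite mulrCA ler_pM2l // -invfM -exprMn lef_pV2 ?posrE ?exprn_gt0 //.
- by rewrite ler_pXn2r // nnegrE ?modulus_ge0 // mulr_ge0 ?modulus_ge0 // ltW.
- by apply: lt_le_trans h; rewrite mulr_gt0.
- by rewrite mulr_gt0.
Qed.

End HarmonicMeasure.

(** * Measurability of discs and of the Blaschke weight *)

Section Discs.
Variable R : realType.
Implicit Types (z c : R[i]) (r : R).

Lemma measurable_modulusB c : measurable_fun setT (fun z => modulus (z - c)).
Proof.
have msqrt : measurable_fun setT (@Num.sqrt R).
  by apply: continuous_measurable_fun; exact: sqrt_continuous.
have h : measurable_fun setT
    (fun z : R[i] => (Re z - Re c) ^+ 2 + (Im z - Im c) ^+ 2).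
  apply: measurable_funD; apply: measurable_funX; apply: measurable_funB => //.
    exact: measurable_Re.
  exact: measurable_Im.
have := measurableT_comp msqrt h; congr measurable_fun.
by apply/funext => z; rewrite /modulus /=; case: z; case: (c).
Qed.

Lemma closed_discE c r : closed_disc c r = [set z | modulus (z - c) <= r].
Proof. by apply/funext => z; rewrite /closed_disc /= normc_le. Qed.

Lemma measurable_closed_disc c r : measurable (closed_disc c r).
Proof.
rewrite closed_discE -[X in measurable X]setTI.
have := measurable_modulusB c measurableT (measurable_itv `]-oo, r]).
by congr (measurable (_ `&` _)); apply/funext => z; rewrite /= in_itv.
Qed.

Lemma measurable_open_disc c r : measurable (open_disc c r).
Proof.
rewrite -[X in measurable X]setTI.
have := measurable_modulusB c measurableT (measurable_itv `]-oo, r[).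
congr (measurable (_ `&` _)); apply/funext => z.
by rewrite /open_disc /= in_itv /= normc_lt.
Qed.

Lemma measurable_outer r : measurable [set z : R[i] | r%:C <= `|z|].
Proof.
rewrite -[X in measurable X]setTI.
have := @measurable_modulus R measurableT _ (measurable_itv `[r, +oo[).
congr (measurable (_ `&` _)); apply/funext => z.
by rewrite /= in_itv /= andbT normc_ge.
Qed.

Lemma measurable_Im_inv : measurable_fun setT (fun z : R[i] => Im z^-1).
Proof.
rewrite (_ : (fun z => _) = (fun z : R[i] => - (Im z * (modulus z ^+ 2)^-1))).
  apply: measurableT_comp => //; apply: measurable_funM.
    exact: measurable_Im.
  apply: (measurableT_comp (@measurable_invr R)); apply: measurable_funX.
  exact: measurable_modulus.
by apply/funext => z; rewrite Im_inv.
Qed.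

Lemma Im_inv_conjE z : Im (z^*%C)^-1 = - Im z^-1.
Proof. by rewrite Im_inv_conj Im_inv opprK. Qed.

Lemma measurable_Im_inv_conj :
  measurable_fun setT (fun z : R[i] => Im (z^*%C)^-1).
Proof.
rewrite (_ : (fun z => _) = (fun z : R[i] => - Im z^-1)).
  by apply: measurableT_comp => //; exact: measurable_Im_inv.
by apply/funext => z; rewrite Im_inv_conjE.
Qed.

Lemma Im_inv_conj_ge0 z : 0 <= Im z -> 0 <= Im (z^*%C)^-1.
Proof. by move=> y0; rewrite Im_inv_conj divr_ge0 ?sqr_ge0. Qed.

Lemma normr_Im_inv z : 0 <= Im z -> `|Im z^-1| = Im (z^*%C)^-1.
Proof.
by move=> y0; rewrite -normrN -Im_inv_conjE ger0_norm // Im_inv_conj_ge0.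
Qed.

End Discs.

(** * Sweeping positive measures onto the real axis, and finiteness under the Blaschke condition *)

Section Sweep.
Variable R : realType.
Local Open Scope ereal_scope.
Implicit Types (nu : set R[i] -> \bar R) (A B : set R[i]).

(** The part of the balayage of a positive measure that comes from the open upper half-plane. *)
Definition sweep_up (m : {measure set R[i] -> \bar R}) B :=
  \int[m]_(z in upper_half_plane) harmonic_measure z B.

Section SweepUp.
Variable m : {measure set R[i] -> \bar R}.

Let sweep_up0 : sweep_up m set0 = 0.
Proof.
apply: integral0_eq => z _; rewrite /harmonic_measure.
by rewrite (_ : [set t : R | _] = set0) ?integral_set0 ?mule0 // -subset0.
Qed.

Let sweep_up_ge0 B : 0 <= sweep_up m B.
Proof. by apply: integral_ge0 => z; exact: harmonic_measure_ge0. Qed.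

Let sweep_up_sigma_additive : semi_sigma_additive (sweep_up m).
Proof.
move=> F mF tF mUF.
have -> : sweep_up m (\bigcup_n F n) = \sum_(n <oo) sweep_up m (F n).
  rewrite /sweep_up -integral_nneseries //.
  - by apply: eq_integral => z /set_mem Hz; rewrite harmonic_measure_bigcup.
  - exact: measurable_upper_half_plane.
  - by move=> n; exact: measurable_harmonic_measure.
  - by move=> n z; exact: harmonic_measure_ge0.
by apply: is_cvg_nneseries => n _ _; exact: sweep_up_ge0.
Qed.

HB.instance Definition _ := isMeasure.Build _ R[i] R (sweep_up m)
  sweep_up0 sweep_up_ge0 sweep_up_sigma_additive.

End SweepUp.

Definition sweep (m : {measure set R[i] -> \bar R}) :
    {measure set R[i] -> \bar R} :=
  measure_add (sweep_up m)
    (mrestr m (@measurable_closed_lower_half_plane R)).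

Lemma sweepE (m : {measure set R[i] -> \bar R}) B :
  sweep m B = sweep_up m B + m (B `&` closed_lower_half_plane).
Proof.
exact: (measure_addE (sweep_up m)
  (mrestr m (@measurable_closed_lower_half_plane R)) B).
Qed.

(** Harmonic measure is at most 1, so sweeping a finite measure gives finite values. This later
    shows that the balayage omits one of the two infinities. *)
Lemma sweep_ltoo (m : {measure set R[i] -> \bar R}) B : measurable B ->
  m setT < +oo -> sweep m B < +oo.
Proof.
move=> mB moo; rewrite sweepE; apply: lte_add_pinfty.
  apply: le_lt_trans moo; apply: (@le_trans _ _ (m upper_half_plane)).
    rewrite -[leRHS]mul1e -integral_cst; last exact: measurable_upper_half_plane.
    apply: ge0_le_integral => //.
    - exact: measurable_upper_half_plane.
    - by move=> z; exact: harmonic_measure_ge0.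
    - exact: measurable_harmonic_measure.
    - by move=> z y0; exact: harmonic_measure_le1.
  apply: le_measure => //; rewrite ?inE //; exact: measurable_upper_half_plane.
apply: le_lt_trans moo; apply: le_measure; rewrite ?inE //.
by apply: measurableI => //; exact: measurable_closed_lower_half_plane.
Qed.

Lemma balayageE nu (hnu : is_charge nu) B : measurable B ->
  balayage nu B = sweep (upper_measure hnu) B - sweep (lower_measure hnu) B.
Proof.
move=> mB; have mL := @measurable_closed_lower_half_plane R.
rewrite /balayage (charge_jordan hnu); last exact: measurableI.
rewrite !sweepE oppeD; first by rewrite addeACA.
by rewrite ge0_adde_def // inE measure_ge0.
Qed.

(** One of the two limits is finite, so they can be subtracted without meeting oo - oo. *)
Lemma measureB_sigma_additive (p n : {measure set R[i] -> \bar R}) :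
  (forall A, measurable A -> p A < +oo) \/
  (forall A, measurable A -> n A < +oo) ->
  semi_sigma_additive (fun B => p B - n B).
Proof.
move=> pn F mF tF mUF.
rewrite [X in X @ _ --> _](_ : _ = (fun k => \sum_(0 <= i < k) p (F i)) \+
    (fun k => - \sum_(0 <= i < k) n (F i))); last first.
  apply/funext => k /=; rewrite big_split /= -sumeN // => i j _ _.
  by rewrite ge0_adde_def // inE.
apply: cvgeD.
- case: pn => [/(_ _ mUF)|/(_ _ mUF)] h.
    by apply: fin_num_adde_defr; rewrite ge0_fin_numE.
  by apply: fin_num_adde_defl; rewrite fin_numN ge0_fin_numE.
- exact: measure_semi_sigma_additive.
- by apply: cvgeN; exact: measure_semi_sigma_additive.
Qed.

Lemma sweep_up_variation nu (hnu : is_charge nu) B : measurable B ->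
  sweep_up (variation_measure hnu) B =
  sweep_up (upper_measure hnu) B + sweep_up (lower_measure hnu) B.
Proof.
move=> mB; apply: (ge0_integral_variation hnu).
- exact: measurable_upper_half_plane.
- by move=> z; exact: harmonic_measure_ge0.
- exact: measurable_harmonic_measure.
Qed.

Lemma sweep_variation nu (hnu : is_charge nu) B : measurable B ->
  sweep (variation_measure hnu) B =
  sweep (upper_measure hnu) B + sweep (lower_measure hnu) B.
Proof.
by move=> mB; rewrite !sweepE sweep_up_variation // addeACA.
Qed.

(** Over a large disc, harmonic measure is at most 1 and the variation is finite. Beyond it, |z - t|
    >= |z| / 2 for all t in the trace of [B], so harmonic measure is at most a constant times the
    Blaschke weight. *)
Lemma sweep_up_bounded_ltoo nu (hnu : is_charge nu) B M :
  blaschke_near_infinity nu -> measurable B -> B `<=` centered_disc M ->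
  sweep_up (variation_measure hnu) B < +oo.
Proof.
(* The maximum with 1 keeps [-N, N] nondegenerate even when [M <= 0]. *)
move=> [r0 r00 hB] mB BM; pose N := Num.max M 1%R.
have N0 : (0 < N)%R by rewrite lt_max ltr01 orbT.
have NN : (- N < N)%R by rewrite gtrN.
pose S : set R[i] := [set x%:C | x in `[(- N)%R, N]%classic].
have mS : measurable S by apply: measurable_real_image; exact: measurable_itv.
have hBS (z : R[i]) : (0 < Im z)%R -> harmonic_measure z B <= harmonic_measure z S.
  move=> y0; apply: (@le_trans _ _ (harmonic_measure z (B `&` S))); last first.
    by apply: harmonic_measureS => //; exact: measurableI.
  (* Only the real trace of [B] counts, and it lies in [-N, N]. *)
  rewrite le_eqVlt; apply/orP; left; apply/eqP.
  rewrite /harmonic_measure; congr (_ * (integral _ _ _)).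
  apply/seteqP; split => [t Bt|t [] //]; split => //; exists t => //.
  have := BM _ Bt; rewrite /centered_disc /= modulus_real in_itv /= -ler_norml.
  by move=> /le_trans; apply; rewrite le_max lexx.
(* Beyond radius [K] the Blaschke integral is available ([r0]) and |z - t| >= |z| / 2 holds on
   [-N, N] ([2 * N]). *)
pose K := Num.max r0 (2 * N)%R.
pose D : set R[i] := centered_disc K.
have mD : measurable D by exact: measurable_centered_disc.
have mU := @measurable_upper_half_plane R.
(* The factor 1/pi, the length of [-N, N], and (1/2)^-2 from [poisson_le] with [b = 1/2]. *)
pose q : R := (pi^-1 * ((N - - N) * (2^-1 ^- 2)))%R.
have q0 : (0 <= q)%R.
  by rewrite mulr_ge0 ?invr_ge0 ?pi_ge0 // mulr_ge0 ?invr_ge0 ?exprn_ge0 //; lra.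
have mh := measurable_harmonic_measure mB.
have hsplit : sweep_up (variation_measure hnu) B =
    \int[variation_measure hnu]_(z in upper_half_plane `&` D) harmonic_measure z B +
    \int[variation_measure hnu]_(z in upper_half_plane `\` D) harmonic_measure z B.
  rewrite -ge0_integral_setU ?setUIDK //.
  - exact: measurableI.
  - exact: measurableD.
  - by move=> z; exact: harmonic_measure_ge0.
  - by apply/disj_setPS => z [[_ Dz] [_ /(_ Dz)]].
rewrite hsplit; apply: lte_add_pinfty.
  apply: (@le_lt_trans _ _ (variation_measure hnu (upper_half_plane `&` D))).
    rewrite -[leRHS]mul1e -integral_cst; last exact: measurableI.
    apply: ge0_le_integral => //.
    - exact: measurableI.
    - by move=> z [y0 _]; exact: harmonic_measure_ge0.
    - by apply: measurable_funS mh => //; exact: subIsetl.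
    - by move=> z [y0 _]; exact: harmonic_measure_le1.
  apply: (variation_measure_disc_ltoo hnu (M := K)); first exact: measurableI.
  exact: subIsetr.
have mOD := @measurable_open_disc R 0%R r0.
have mw (E : set R[i]) : measurable_fun E (fun z : R[i] => (Im (z^*%C)^-1%R)%:E).
  by apply/measurable_EFinP; apply: measurable_funTS; exact: measurable_Im_inv_conj.
have w0 (z : R[i]) : (0 < Im z)%R -> 0 <= (Im (z^*%C)^-1%R)%:E.
  by move=> y0; rewrite lee_fin Im_inv_conj_ge0 // ltW.
apply: (@le_lt_trans _ _ (q%:E * \int[variation_measure hnu]_(z in
    upper_half_plane `\` open_disc 0%R r0) (Im (z^*%C)^-1%R)%:E)); last first.
  by apply: lte_mul_pinfty.
apply: (@le_trans _ _ (q%:E * \int[variation_measure hnu]_(z in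
    upper_half_plane `\` D) (Im (z^*%C)^-1%R)%:E)); last first.
  apply: lee_wpmul2l; first by rewrite lee_fin.
  apply: ge0_subset_integral => //.
  - exact: measurableD.
  - exact: measurableD.
  - by move=> z [y0 _]; exact: w0.
  - move=> z [y0 Dz]; split => // Oz; apply: Dz.
    move: Oz; rewrite /open_disc /= subr0 normc_lt => /ltW Oz.
    by apply: (le_trans Oz); rewrite le_max lexx.
rewrite -ge0_integralZl_EFin //; last 2 first.
- exact: measurableD.
- by move=> z [y0 _]; exact: w0.
apply: ge0_le_integral => //.
- exact: measurableD.
- by move=> z [y0 _]; exact: harmonic_measure_ge0.
- by apply: measurable_funS mh => //; exact: subDsetl.
- by apply: measurable_funeM.
- move=> z [y0 /negP]; rewrite -ltNge => Kz.
  apply: (le_trans (hBS z y0)).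
  apply: (le_trans (harmonic_measure_itv_le y0 NN
    (q := (2^-1 ^- 2 * Im (z^*%C)^-1)%R) _)).
    move=> t; rewrite -ler_norml => tN; apply: poisson_le => //.
    apply: le_trans (ler_modulusB _ _); rewrite modulus_real.
    have : (2 * N < modulus z)%R.
      by apply: le_lt_trans Kz; rewrite le_max lexx orbT.
    lra.
  by rewrite -EFinM lee_fin /q !mulrA.
Qed.

End Sweep.

(** * The balayage is a charge; its variation and distribution function are controlled by the
    sweep *)

Section Balayage.
Variable R : realType.
Local Open Scope ereal_scope.
Implicit Types (nu : set R[i] -> \bar R) (A B : set R[i]) (z : R[i]).

Lemma sweep_bounded_ltoo nu (hnu : is_charge nu) B M :
  blaschke_near_infinity nu -> measurable B -> B `<=` centered_disc M ->
  sweep (variation_measure hnu) B < +oo.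
Proof.
move=> hB mB BM; rewrite sweepE; apply: lte_add_pinfty.
  exact: (sweep_up_bounded_ltoo hnu hB mB BM).
have mL := @measurable_closed_lower_half_plane R.
apply: (variation_measure_disc_ltoo hnu (M := M)); first exact: measurableI.
by apply: subset_trans BM; exact: subIsetl.
Qed.

Lemma sweep_jordan_ltoo nu (hnu : is_charge nu) B M :
  blaschke_near_infinity nu -> measurable B -> B `<=` centered_disc M ->
  sweep (upper_measure hnu) B < +oo /\ sweep (lower_measure hnu) B < +oo.
Proof.
move=> hB mB BM; have := sweep_bounded_ltoo hnu hB mB BM.
by rewrite sweep_variation // => h; split; apply: le_lt_trans h;
  rewrite (leeDl, leeDr) // measure_ge0.
Qed.

Lemma balayage_charge nu : is_charge nu -> blaschke_near_infinity nu ->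
  is_charge (balayage nu).
Proof.
move=> hnu hB; have [_ _ nuoo _] := hnu.
(* If [nu] omits +oo its upper variation is finite, if it omits -oo its lower variation is. The
   matching sweep is then finite, and the balayage omits the same infinity. *)
have swoo :
    (forall A, measurable A -> sweep (upper_measure hnu) A < +oo) \/
    (forall A, measurable A -> sweep (lower_measure hnu) A < +oo).
  case: nuoo => h; [left|right] => A mA; apply: sweep_ltoo => //.
    exact: (upper_variation_ltoo hnu h measurableT).
  exact: (lower_variation_ltoo hnu h measurableT).
split.
- by rewrite (balayageE hnu) // !measure0 sube0.
- move=> F mF tF mUF; rewrite (balayageE hnu) //.
  under eq_fun do under eq_bigr do rewrite (balayageE hnu) //.
  exact: measureB_sigma_additive.
- case: swoo => h; [left|right] => A mA; have := h A mA;
    rewrite (balayageE hnu) //.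
    move=> pA; rewrite -ltey; apply: le_lt_trans pA.
    by rewrite geeDl // oppe_le0 measure_ge0.
  move=> nA; rewrite -ltNye; apply: (@lt_le_trans _ _ (- sweep (lower_measure hnu) A)).
    by rewrite lteNr.
  by rewrite leeDr // measure_ge0.
- move=> K cK; have mK := compact_measurable_complex cK.
  have [M KM] := compact_bounded_complex cK.
  have [pK nK] := sweep_jordan_ltoo hnu hB mK KM.
  by rewrite (balayageE hnu) // fin_numB !ge0_fin_numE // pK.
Qed.

(** Let p and n be the sweeps of the Jordan parts. For Borel B inside A, p(B) - n(B) <= p(A) and
    n(B) - p(B) <= n(A); the two suprema add up to at most p(A) + n(A). *)
Lemma balayage_variation_le nu (hnu : is_charge nu) A M :
  blaschke_near_infinity nu -> measurable A -> A `<=` centered_disc M ->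
  charge_total_variation (balayage nu) A <= sweep (variation_measure hnu) A.
Proof.
move=> hB mA AM; rewrite sweep_variation // /charge_total_variation.
have incr (m : {measure set R[i] -> \bar R}) B : measurable B -> B `<=` A ->
    m B <= m A by move=> mB BA; apply: le_measure; rewrite ?inE.
apply: leeD; apply: ge_ereal_sup => _ [B [mB BA] <-].
  rewrite (balayageE hnu) //.
  by apply: (le_trans _ (incr _ _ mB BA)); rewrite geeDl // oppe_le0 measure_ge0.
have BM : B `<=` centered_disc M by exact: subset_trans AM.
have [pB nB] := sweep_jordan_ltoo hnu hB mB BM.
(* Both sweeps are finite on bounded sets, so the opposite of p - n is n - p. *)
rewrite (balayageE hnu) // fin_num_oppeB ?ge0_fin_numE // addeC.
by apply: (le_trans _ (incr _ _ mB BA)); rewrite geeDl // oppe_le0 measure_ge0.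
Qed.

(** If both points are negative or both nonnegative, the increment is the mass of a half-open
    interval between them; if [t1 < 0 <= t2] it is the mass of the closed one. Finiteness on bounded
    sets justifies the subtractions. *)
Lemma distribution_functionB_le (V : {measure set R[i] -> \bar R}) (t1 t2 : R) :
  (forall A M, measurable A -> A `<=` centered_disc M -> V A < +oo) ->
  (t1 < t2)%R ->
  distribution_function V t2 - distribution_function V t1 <=
  V [set x%:C | x in `[t1, t2]%classic].
Proof.
move=> Vfin t12.
have mI (i : interval R) : measurable [set x%:C | x in [set` i]].
  by apply: measurable_real_image; exact: measurable_itv.
have finI (i : interval R) M : (forall x, x \in i -> `|x| <= M)%R ->
    V [set x%:C | x in [set` i]] \is a fin_num.
  move=> iM; rewrite ge0_fin_numE //; apply: (Vfin _ M) => // _ [x xi <-].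
  by rewrite /centered_disc /= modulus_real iM.
have sub (i j k : interval R) : (forall x, x \in i -> (x \in j) || (x \in k)) ->
    V [set x%:C | x in [set` i]] <=
    V [set x%:C | x in [set` j]] + V [set x%:C | x in [set` k]].
  move=> ijk; apply: (le_trans _ (measureU2 _ (mI j) (mI k))).
  apply: le_measure; rewrite ?inE //; first exact: measurableU.
  by move=> _ [x /= /ijk /orP[xj|xk] <-]; [left|right]; exists x.
rewrite /distribution_function; case: ltP => t20; case: ltP => t10.
- rewrite oppeK addeC leeBlDr; last first.
    apply: (finI _ `|t2|%R) => x; rewrite in_itv /= => /andP[h1 h2].
    by rewrite (ltr0_norm h2) (ltr0_norm t20) lerN2.
  apply: sub => x; rewrite !in_itv /= => /andP[-> ->].
  by rewrite /= andbT le_total.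
- by have := lt_trans t12 t20; rewrite ltNge t10.
- rewrite oppeK -measureU; [|exact: mI|exact: mI|].
    apply: le_measure; rewrite ?inE; [by apply: measurableU|exact: mI|].
    move=> w [] [x] /=; rewrite in_itv /= => /andP[h1 h2] <-; exists x => //=;
      rewrite in_itv /=; apply/andP; split => //.
      by apply: (le_trans _ h1); apply: ltW.
    by apply: (le_trans _ t20); apply: ltW.
  rewrite -subset0 => w [[x /=]]; rewrite in_itv /= => /andP[h1 h2] <- [y /=].
  by rewrite in_itv /= => /andP[h3 h4] [yx]; move: h4; rewrite yx ltNge h1.
- rewrite leeBlDr; last first.
    apply: (finI _ t1) => x; rewrite in_itv /= => /andP[h1 h2].
    by rewrite ger0_norm.
  apply: sub => x; rewrite !in_itv /= => /andP[-> ->].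
  by rewrite /= andbT le_total.
Qed.

End Balayage.

(** * The three-zone bound for the harmonic measure of a chord, and its integration *)

Section PointwiseBound.
Variables (R : realType) (t1 t2 a : R).
Hypotheses (t12 : t1 < t2) (a0 : 0 < a) (a1 : a < 1).
Implicit Types (z : R[i]) (s t : R).

Let t0 : R := (t1 + t2) / 2.
Let r : R := (t2 - t1) / 2.
Let T : R := Num.max `|t1| `|t2|.
Let b : R := a + 1 / a.
Let A : R := b * T.

Let r0 : 0 < r. Proof. by rewrite divr_gt0 // subr_gt0. Qed.

(** [T] is the largest modulus on the chord, reached at the end beyond the centre as seen from 0. It
    is used in the form T - r = |t0|. *)
Lemma chord_maxE : T = `|t0| + r.
Proof.
rewrite /T /t0 /r; have h0 := t12.
by case: (leP 0 t1) => h1; case: (leP 0 t2) => h2;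
  case: (leP 0 ((t1 + t2) / 2)) => h3;
  rewrite ?(ger0_norm h1) ?(ger0_norm h2) ?(ger0_norm h3)
    ?(ltr0_norm h1) ?(ltr0_norm h2) ?(ltr0_norm h3); case: leP => h4; lra.
Qed.

Let rT : r <= T. Proof. by rewrite chord_maxE lerDr. Qed.

Let T0 : 0 < T. Proof. exact: lt_le_trans rT. Qed.

Let b2 : 2 <= b.
Proof.
have -> : b = 2 + (1 - a) ^+ 2 / a by rewrite /b; field; rewrite gt_eqF.
by rewrite lerDl divr_ge0 ?sqr_ge0 // ltW.
Qed.

Let abE : a * b = a ^+ 2 + 1.
Proof. by rewrite /b; field; rewrite gt_eqF. Qed.

Let TA : 2 * T <= A.
Proof. by rewrite /A ler_pM2r. Qed.

Let mod_t0 z : modulus z <= modulus (z - t0%:C) + (T - r).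
Proof.
rewrite chord_maxE addrK -(modulus_real t0).
by apply: le_trans (ler_modulusD _ _); rewrite subrK.
Qed.

(** With s = |z - t0|, |z - t| >= s - r and |z| <= s + T - r reduce the claim to (1 - a) T + a r <=
    a s. The left side is at most T because r <= T, while a s exceeds a A = (a^2 + 1) T. *)
Lemma far_modulus_le z t : A < modulus (z - t0%:C) -> t1 <= t <= t2 ->
  (1 - a) * modulus z <= modulus (z - t%:C).
Proof.
move=> As /andP[ht1 ht2]; set s := modulus (z - t0%:C) in As *.
have h1 : modulus (z - t%:C) >= s - r.
  have -> : z - t%:C = (z - t0%:C) - (t - t0)%:C by rewrite rmorphB /=; ring.
  apply: le_trans (ler_modulusB _ _); rewrite modulus_real lerB // ler_norml.
  by rewrite /t0 /r; have := t12; lra.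
apply: le_trans h1.
apply: (@le_trans _ _ ((1 - a) * (s + (T - r)))).
  by rewrite ler_pM2l ?subr_gt0 //; exact: mod_t0.
have h2 : a ^+ 2 * T + T <= a * s.
  have -> : a ^+ 2 * T + T = a * A by rewrite /A mulrA abE; ring.
  by rewrite ler_pM2l // ltW.
have h3 : a * r <= a * T by rewrite ler_pM2l.
have h4 : 0 <= a ^+ 2 * T by rewrite mulr_ge0 ?sqr_ge0 // ltW.
nra.
Qed.

(** Places the far zone inside the domain |z| >= T of the Blaschke-type integral; it rests on A >= 2
    T. *)
Lemma far_modulus_ge z : A < modulus (z - t0%:C) -> T <= modulus z.
Proof.
move=> As.
have : modulus (z - t0%:C) <= modulus z + (T - r).
  rewrite chord_maxE addrK -(modulus_real t0) -lerBlDr.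
  rewrite lerBlDr.
  have := ler_modulusD z (- t0%:C).
  by rewrite -rmorphN /= !modulus_real normrN.
by have := TA; have := r0; lra.
Qed.

Let chord : set R[i] := [set x%:C | x in `[t1, t2]%classic].

Lemma harmonic_measure_near z : 0 < Im z -> r < modulus (z - t0%:C) ->
  (harmonic_measure z chord <=
   (2 / pi * atan (r / modulus (z - t0%:C)))%:E)%E.
Proof.
move=> y0 rs; rewrite harmonic_measure_itv // lee_fin.
(* Translation by [t0] turns the chord into [-r, r] and [z] into u + i Im z, of modulus [s]. *)
set s := modulus (z - t0%:C) in rs *; pose u := Re z - t0.
have -> : t1 - Re z = - (r + u) by rewrite /u /r /t0; field.
have -> : t2 - Re z = r - u by rewrite /u /r /t0; field.
rewrite mulNr atanN opprK (mulrC 2) -mulrA ler_pM2l ?invr_gt0 ?pi_gt0 //.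
apply: atan_chord_le => //; first exact: modulus_ge0.
by rewrite /s sqr_modulus /u; case: (z) => x y /=; rewrite subr0.
Qed.

Definition radial_weight t : R := (t ^+ 2 + r ^+ 2)^-1.

Lemma radial_weight_ge0 t : 0 <= radial_weight t.
Proof. by rewrite invr_ge0 addr_ge0 ?sqr_ge0. Qed.

Lemma measurable_radial_weight D : measurable_fun D radial_weight.
Proof.
apply: measurable_funTS; apply: (measurableT_comp (@measurable_invr R)).
by apply: measurable_funD => //; exact: measurable_funX.
Qed.

Lemma integral_radial_weight s : s <= A ->
  (\int[lebesgue_measure]_(t in `[s, A]) (radial_weight t)%:E =
   (r^-1 * (atan (A / r) - atan (s / r)))%:E)%E.
Proof.
rewrite le_eqVlt => /predU1P[->|sA].
  by rewrite set_itv1 integral_set1 subrr mulr0.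
(* The Poisson kernel at the point i r is [r] times the radial weight. *)
have := @integral_poisson R 0 r s A r0 sA; rewrite !subr0 => H.
rewrite EFinM -H -ge0_integralZl_EFin //.
- apply: eq_integral => t _; rewrite subr0 -EFinM /radial_weight; congr EFin.
  by rewrite mulrA mulVf ?mul1r // gt_eqF.
- by move=> t _; rewrite lee_fin divr_ge0 ?addr_ge0 ?sqr_ge0 // ltW.
- apply/measurable_EFinP; apply: measurable_funTS.
  by apply: continuous_measurable_fun; exact: continuous_poisson.
- by rewrite invr_ge0 ltW.
Qed.

(* Layer-cake form of the integration by parts: the decreasing function
   [atan (r / s)] is its value at [A] plus the integral of its derivative. *)
Lemma atan_layer s : r < s -> s <= A ->
  2 / pi * atan (r / s) <=
  r * b / T + (2 * r / pi) * (r^-1 * (atan (A / r) - atan (s / r))).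
Proof.
move=> rs sA; have s0 : 0 < s by exact: lt_trans rs.
have A0 : 0 < A by exact: lt_le_trans sA.
have p0 := pi_gt0 R.
(* Complementary angles replace atan (v / r) by atan (r / v), so the layer term becomes (2/pi) (atan
   (r / s) - atan (r / A)). *)
have inv (v : R) : 0 < v -> atan (v / r) = pi / 2 - atan (r / v).
  move=> v0; have vr : (v / r)^-1 = r / v by exact: invf_div.
  by have := @atanDV R (v / r) (divr_gt0 v0 r0); rewrite vr; lra.
rewrite !inv //.
have eqE (p q x y : R) : p != 0 -> q != 0 ->
    2 * q / p * (q^-1 * (p / 2 - x - (p / 2 - y))) = 2 / p * y - 2 / p * x.
  by move=> pn0 qn0; field; rewrite pn0.
rewrite eqE ?gt_eqF //.
(* Only the value at [A] is left: 2/pi <= 1 and atan x <= x bound it by r / A = r / (b T), and b >=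
   1 gives 1/b <= b. *)
suff : 2 / pi * atan (r / A) <= r * b / T by lra.
apply: (@le_trans _ _ (r / A)).
  have rA0 : 0 < r / A := divr_gt0 r0 A0.
  rewrite -[leRHS]mul1r; apply: ler_pM; last exact: atan_le.
  - by rewrite divr_ge0 // ltW.
  - by rewrite -atan0 le_atan // ltW.
  - by rewrite ler_pdivrMr // mul1r; exact: pi_ge2.
have hb : 1 <= b by apply: le_trans b2; rewrite ler1n.
have hA : A^-1 <= b / T.
  rewrite /A invfM ler_pM2r ?invr_gt0 //; apply: (le_trans _ hb).
  by rewrite invf_le1 //; apply: (lt_le_trans ltr01 hb).
by rewrite -[r * b / T](mulrA r b) ler_pM2l.
Qed.

(** The lower limit |z - t0| sits in the integrand, so that the range of [t] is independent of [z]
    and Tonelli's theorem applies. *)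
Definition layer z : \bar R :=
  (\int[lebesgue_measure]_(t in `[r, A])
    (if modulus (z - t0%:C)%R <= t then radial_weight t else 0)%:E)%E.

Lemma layer_ge0 z : (0 <= layer z)%E.
Proof.
apply: integral_ge0 => t _; case: ifP => _ //.
by rewrite lee_fin; exact: radial_weight_ge0.
Qed.

Let outer : set R[i] := [set z | T%:C <= `|z|].

(** Extension by 0 to |z| < T allows integration over the whole upper half-plane. *)
Definition far_weight z : \bar R :=
  ((fun z : R[i] => (`|Im z^-1|)%:E) \_ outer) z.

Lemma far_weight_ge0 z : (0 <= far_weight z)%E.
Proof. by rewrite /far_weight patchE; case: ifP => // _; rewrite lee_fin. Qed.

Let c1_ge0 : 0 <= r * b / T.
Proof.
apply: divr_ge0; last exact: ltW.
by apply: mulr_ge0; [exact: ltW|exact: (le_trans _ b2)].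
Qed.

Let c2_ge0 : 0 <= 2 * r / (pi * (1 - a) ^+ 2).
Proof.
apply: divr_ge0; apply: mulr_ge0; rewrite ?pi_ge0 ?sqr_ge0 //.
exact: ltW.
Qed.

Let c3_ge0 : 0 <= 2 * r / pi.
Proof.
by apply: divr_ge0; rewrite ?pi_ge0 //; apply: mulr_ge0 => //; exact: ltW.
Qed.

(** All four terms are nonnegative, and each zone uses its own: the first for s <= r, the second and
    fourth for r < s <= A, the third for s > A, where s = |z - t0|. *)
Lemma harmonic_measure_chord_le z : 0 < Im z ->
  (harmonic_measure z chord <=
    (\1_(closed_disc t0%:C r) z)%:E +
    (r * b / T)%:E * (\1_(closed_disc t0%:C A) z)%:E +
    (2 * r / (pi * (1 - a) ^+ 2))%:E * far_weight z +
    (2 * r / pi)%:E * layer z)%E.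
Proof.
move=> y0.
have mchord : measurable chord.
  by apply: measurable_real_image; exact: measurable_itv.
have e1 : (0 <= (\1_(closed_disc t0%:C r) z)%:E :> \bar R)%E by rewrite lee_fin.
have e2 : (0 <= (r * b / T)%:E * (\1_(closed_disc t0%:C A) z)%:E)%E.
  by rewrite mule_ge0 // lee_fin.
have e3 : (0 <= (2 * r / (pi * (1 - a) ^+ 2))%:E * far_weight z)%E.
  by rewrite mule_ge0 ?far_weight_ge0 // lee_fin.
have e4 : (0 <= (2 * r / pi)%:E * layer z)%E.
  by rewrite mule_ge0 ?layer_ge0 // lee_fin.
have discE s : (z \in closed_disc t0%:C s) = (modulus (z - t0%:C) <= s).
  by rewrite closed_discE; apply/idP/idP => [/set_mem //|h]; exact/mem_set.
have [sr|rs] := leP (modulus (z - t0%:C)) r.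
  apply: (le_trans (harmonic_measure_le1 y0 mchord)).
  rewrite indicE discE sr -!addeA leeDl //.
  by rewrite !adde_ge0.
have [sA|As] := leP (modulus (z - t0%:C)) A.
  apply: (le_trans (harmonic_measure_near y0 rs)).
  rewrite [X in (_ + _ * X%:E)%E]indicE discE sA mule1.
  apply: (@le_trans _ _ ((r * b / T)%:E + (2 * r / pi)%:E * layer z)%E); last first.
    by apply: leeD => //; rewrite -addeA addeCA leeDl // adde_ge0.
  apply: (@le_trans _ _ ((r * b / T)%:E + (2 * r / pi)%:E *
      \int[lebesgue_measure]_(t in `[modulus (z - t0%:C)%R, A])
        (radial_weight t)%:E)%E).
    by rewrite integral_radial_weight // -EFinM -EFinD lee_fin; exact: atan_layer.
  rewrite leeD2l //; apply: lee_wpmul2l; first by rewrite lee_fin.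
  (* Extended by 0 to the line, the integrands agree for t between |z - t0| and A, because r < |z -
     t0|; elsewhere the left one vanishes. *)
  rewrite /layer [leLHS]integral_mkcond [leRHS]integral_mkcond.
  apply: ge0_le_integral => //.
  - by move=> t _; rewrite patchE; case: ifP => // _; rewrite lee_fin radial_weight_ge0.
  - apply/(measurable_restrictT _ _).1 => //.
    by apply/measurable_EFinP; exact: measurable_radial_weight.
  - apply/(measurable_restrictT _ _).1 => //.
    apply/measurable_EFinP; apply: measurable_funTS.
    apply: measurable_fun_ifT => //; last exact: measurable_radial_weight.
    exact: measurable_fun_ler.
  - move=> t _; rewrite !patchE; case: ifPn => [/set_mem|_].
      rewrite /= in_itv /= => /andP[st tA]; rewrite mem_set ?st //=.
      by rewrite in_itv /= tA andbT (le_trans _ st) // ltW.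
    by case: ifP => // _; case: ifP => // _; rewrite lee_fin radial_weight_ge0.
apply: (@le_trans _ _ ((2 * r / (pi * (1 - a) ^+ 2))%:E * far_weight z)%E); last first.
  by rewrite [leRHS]addeAC leeDr // !adde_ge0.
have zT : z \in outer by apply/mem_set; rewrite /outer /= normc_ge far_modulus_ge.
rewrite /far_weight patchE zT normr_Im_inv ?(ltW y0) //.
have a1' : 0 < 1 - a by rewrite subr_gt0.
apply: (le_trans (harmonic_measure_itv_le y0 t12
    (q := (1 - a) ^- 2 * Im (z^*%C)^-1) _)).
  by move=> t ht; apply: poisson_le => //; exact: far_modulus_le.
rewrite -EFinM lee_fin le_eqVlt; apply/orP; left; apply/eqP.
have -> : t2 - t1 = 2 * r by rewrite /r; field.
have eqE (p k q w : R) : p^-1 * (k * (q^-1 * w)) = k / (p * q) * w.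
  by rewrite invfM; ring.
exact: eqE.
Qed.

Lemma measurable_layer_kernel : measurable_fun setT
  (fun p : R[i] * R =>
     \1_(`[r, A]%classic : set R) p.2 *
     (if modulus (p.1 - t0%:C) <= p.2 then radial_weight p.2 else 0)).
Proof.
have m2 : measurable_fun setT (fun p : R[i] * R => p.2) by exact: measurable_snd.
have mM : measurable_fun setT (fun p : R[i] * R => modulus (p.1 - t0%:C)).
  exact: (measurableT_comp (measurable_modulusB t0%:C) measurable_fst).
have mI : measurable_fun setT (\1_(`[r, A]%classic : set R) : R -> R).
  by apply: measurable_indic; exact: measurable_itv.
apply: measurable_funM; first exact: (measurableT_comp mI m2).
apply: measurable_fun_ifT => //; first exact: measurable_fun_ler.
exact: (measurableT_comp (measurable_radial_weight (D := setT)) m2).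
Qed.

Section Layer.
Variable m : {sigma_finite_measure set R[i] -> \bar R}.
Local Open Scope ereal_scope.

Let K (p : R[i] * R) : \bar R :=
  (\1_(`[r, A]%classic : set R) p.2 *
   (if modulus (p.1 - t0%:C) <= p.2 then radial_weight p.2 else 0))%:E.

Let K0 p : 0 <= K p.
Proof.
rewrite lee_fin mulr_ge0 //; case: ifP => // _; exact: radial_weight_ge0.
Qed.

Let mK : measurable_fun setT K.
Proof. by apply/measurable_EFinP; exact: measurable_layer_kernel. Qed.

Let layerE z : layer z = \int[@lebesgue_measure R]_t K (z, t).
Proof.
rewrite /layer integral_mkcond; apply: eq_integral => t _.
rewrite patchE /K indicE /=; case: ifPn => tI; first by rewrite mul1r.
by rewrite mul0r.
Qed.

Lemma measurable_layer : measurable_fun setT layer.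
Proof.
have := @measurable_fun_fubini_tonelli_F _ _ R[i] (measurableTypeR R) R
  (@lebesgue_measure R) K mK K0.
by congr measurable_fun; apply/funext => z; rewrite layerE.
Qed.

(** By Tonelli: for fixed t in [r, A] the kernel is the radial weight times the indicator of the
    disc of radius t about [t0]. *)
Lemma integral_layer : \int[m]_z layer z =
  \int[@lebesgue_measure R]_(t in `[r, A]%classic)
    (m (closed_disc t0%:C t) * (radial_weight t)%:E).
Proof.
transitivity (\int[m]_z \int[@lebesgue_measure R]_t K (z, t)).
  by apply: eq_integral => z _; rewrite layerE.
rewrite (@fubini_tonelli _ _ R[i] (measurableTypeR R) R m (@lebesgue_measure R) K
  mK K0) [RHS]integral_mkcond; apply: eq_integral => t _.
rewrite patchE; case: ifPn => tI; last first.
  by apply: integral0_eq => z _; rewrite /K /= indicE (negbTE tI) mul0r.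
have mD : measurable (closed_disc t0%:C t) by exact: measurable_closed_disc.
rewrite muleC -(integral_cst _ mD) [RHS]integral_mkcond.
apply: eq_integral => z _; rewrite patchE /K /= indicE tI mul1r.
have -> : (z \in closed_disc t0%:C t) = (modulus (z - t0%:C)%R <= t)%R.
  by rewrite closed_discE; apply/idP/idP => [/set_mem //|h]; exact/mem_set.
by case: ifP.
Qed.

Lemma sweep_chord_le :
  sweep_up m chord + m chord <=
    m (closed_disc t0%:C r) +
    (r * b / T)%:E * m (closed_disc t0%:C A) +
    (2 * r / (pi * (1 - a) ^+ 2))%:E *
      \int[m]_(z in outer) (`|Im z^-1|%R)%:E +
    (2 * r / pi)%:E *
      \int[@lebesgue_measure R]_(t in `[r, A]%classic)
        (m (closed_disc t0%:C t) * (radial_weight t)%:E).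
Proof.
have mU := @measurable_upper_half_plane R.
have mD s := @measurable_closed_disc R t0%:C s.
have mchord : measurable chord.
  by apply: measurable_real_image; exact: measurable_itv.
have mind s : measurable_fun setT
    (fun z : R[i] => (\1_(closed_disc t0%:C s) z)%:E : \bar R).
  by apply/measurable_EFinP; exact: measurable_indic.
have mout : measurable outer by exact: measurable_outer.
have mfar : measurable_fun setT far_weight.
  apply/(measurable_restrictT _ _).1 => //.
  apply/measurable_EFinP; apply: measurable_funTS.
  by apply: measurableT_comp => //; exact: measurable_Im_inv.
have far0 z := far_weight_ge0 z.
have lay0 z := layer_ge0 z.
have mlay := measurable_layer.
have ind0 s z : 0 <= (\1_(closed_disc t0%:C s) z)%:E :> \bar R by rewrite lee_fin.
have step : sweep_up m chord <=
    \int[m]_(z in upper_half_plane) (\1_(closed_disc t0%:C r) z)%:E +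
    (r * b / T)%:E *
      \int[m]_(z in upper_half_plane) (\1_(closed_disc t0%:C A) z)%:E +
    (2 * r / (pi * (1 - a) ^+ 2))%:E *
      \int[m]_(z in upper_half_plane) far_weight z +
    (2 * r / pi)%:E * \int[m]_(z in upper_half_plane) layer z.
  have ms s := @measurable_funS _ _ _ _ setT _ _ measurableT (subsetT _) (mind s).
  have mf := @measurable_funS _ _ _ _ setT _ _ measurableT (subsetT _) mfar.
  have ml := @measurable_funS _ _ _ _ setT _ _ measurableT (subsetT _) mlay.
  rewrite -!ge0_integralZl_EFin //.
  rewrite -ge0_integralD //; last 2 first.
  - by move=> z _; rewrite mule_ge0 // lee_fin.
  - by apply: measurable_funeM.
  rewrite -ge0_integralD //; last 4 first.
  - by move=> z _; rewrite adde_ge0 // mule_ge0 // lee_fin.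
  - by apply: emeasurable_funD => //; apply: measurable_funeM.
  - by move=> z _; rewrite mule_ge0 // lee_fin.
  - by apply: measurable_funeM.
  rewrite -ge0_integralD //; last 4 first.
  - by move=> z _; rewrite !adde_ge0 // mule_ge0 // lee_fin.
  - by apply: emeasurable_funD; [apply: emeasurable_funD => //|];
      apply: measurable_funeM.
  - by move=> z _; rewrite mule_ge0 // lee_fin.
  - by apply: measurable_funeM.
  apply: ge0_le_integral => //.
  - by move=> z y0; exact: harmonic_measure_ge0.
  - exact: measurable_harmonic_measure.
  - by apply: emeasurable_funD;
      [apply: emeasurable_funD; [apply: emeasurable_funD => //|]|];
      apply: measurable_funeM.
  - by move=> z y0; exact: harmonic_measure_chord_le.
(* The part of the disc in the open upper half-plane and the chord are disjoint subsets of the disc,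
   so its mass covers both. *)
have i1 : \int[m]_(z in upper_half_plane) (\1_(closed_disc t0%:C r) z)%:E + m chord
    <= m (closed_disc t0%:C r).
  rewrite integral_indic // -measureU //; last 2 first.
  - exact: measurableI.
  - rewrite -subset0 => z [[_]]; rewrite /upper_half_plane /= => y0 [x _ xz].
    by move: y0; rewrite -xz /= ltxx.
  apply: le_measure; rewrite ?inE //.
    by apply: measurableU => //; exact: measurableI.
  move=> z [[] //|[x]]; rewrite /= in_itv /= => /andP[h1 h2] <-.
  rewrite closed_discE /= -rmorphB /= modulus_real ler_norml /t0 /r.
  by have := h1; have := h2; lra.
have i2 : \int[m]_(z in upper_half_plane) (\1_(closed_disc t0%:C A) z)%:E
    <= m (closed_disc t0%:C A).
  rewrite integral_indic //; apply: le_measure; rewrite ?inE //.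
  exact: measurableI.
have i3 : \int[m]_(z in upper_half_plane) far_weight z <=
    \int[m]_(z in outer) (`|Im z^-1|%R)%:E.
  rewrite [leRHS]integral_mkcond; apply: ge0_subset_integral => //.
have i4 : \int[m]_(z in upper_half_plane) layer z <=
    \int[@lebesgue_measure R]_(t in `[r, A]%classic)
        (m (closed_disc t0%:C t) * (radial_weight t)%:E).
  by rewrite -integral_layer; apply: ge0_subset_integral.
apply: (le_trans (leeD2r _ step)).
have sum_le (u v w x y u' v' w' x' : \bar R) : u + y <= u' -> v <= v' ->
    w <= w' -> x <= x' -> u + v + w + x + y <= u' + v' + w' + x'.
  move=> h1 h2 h3 h4; have -> : u + v + w + x + y = u + y + v + w + x.
    by rewrite (addeAC _ x) (addeAC _ w) (addeAC _ v).
  by do 3 apply: leeD => //.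
by apply: sum_le => //; apply: lee_wpmul2l; rewrite ?lee_fin.
Qed.

End Layer.

End PointwiseBound.

(** * Finiteness of the balayage and the estimate, by restriction to the closed upper half-plane *)

Theorem mainTheorem1 (R : realType) (nu : set R[i] -> \bar R)
    (nu_charge : is_charge nu) (nu_blaschke : blaschke_near_infinity nu) :
  [/\ forall B : set R[i], measurable B -> bounded_set (B : set R[i]^o) ->
        charge_integral nu upper_half_plane (fun z => harmonic_measure z B)
          \is a fin_num,
      is_charge (balayage nu) &
      forall t1 t2 a : R, t1 < t2 -> 0 < a -> a < 1 ->
        let t0 : R := (t1 + t2) / 2 in
        let r : R := (t2 - t1) / 2 in
        let T : R := Num.max `|t1| `|t2| in
        let mu :=
          charge_total_variation (charge_restr nu closed_upper_half_plane) in
        let nubal := charge_total_variation (balayage nu) in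
        (distribution_function nubal t2 - distribution_function nubal t1
         <= mu (closed_disc t0%:C r)
            + mu [set t1%:C; t2%:C]
            + (r * (a + 1 / a) / T)%:E
              * mu (closed_disc t0%:C ((a + 1 / a) * T)%R)
            + (2 * r / (pi * (1 - a) ^+ 2))%:E
              * \int[mu]_(z in [set z : R[i] | (T%:C <= `|z|)%R])
                  (`|complex.Im z^-1|%R)%:E
            + (2 * r / pi)%:E
              * \int[@lebesgue_measure R]_(t in
                  `[r, ((a + 1 / a) * T)%R]%classic)
                  (mu (closed_disc t0%:C t) * ((t ^+ 2 + r ^+ 2)^-1)%:E))%E].
Proof.
have hbal := balayage_charge nu_charge nu_blaschke.
split=> [B mB bB| |t1 t2 a t12 a0 a1].
- have [M BM] := bounded_set_centered_disc bB.
  have := sweep_up_bounded_ltoo nu_charge nu_blaschke mB BM.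
  rewrite sweep_up_variation // => foo.
  have p0 := measure_ge0 (sweep_up (upper_measure nu_charge)) B.
  have n0 := measure_ge0 (sweep_up (lower_measure nu_charge)) B.
  (* The two terms of [charge_integral] are sweeps of the Jordan parts, nonnegative with a finite
     sum. *)
  rewrite -[charge_integral _ _ _]/(sweep_up (upper_measure nu_charge) B -
    sweep_up (lower_measure nu_charge) B)%E.
  by rewrite fin_numB !ge0_fin_numE //; apply/andP; split; apply: le_lt_trans foo;
    rewrite (leeDl, leeDr).
- exact: hbal.
- cbv zeta; set mu := charge_total_variation (charge_restr _ _).
  have mC := @measurable_closed_upper_half_plane R.
  have mE A : mu A =
      variation_measure nu_charge (A `&` closed_upper_half_plane).
    exact: charge_total_variation_restr.
  pose chord : set R[i] := [set x%:C | x in `[t1, t2]%classic].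
  have mchord : measurable chord.
    by apply: measurable_real_image; exact: measurable_itv.
  have chordM : chord `<=` centered_disc (Num.max `|t1| `|t2|).
    move=> z [x /=]; rewrite in_itv /= => /andP[h1 h2] <-.
    rewrite /centered_disc /= modulus_real ler_norml.
    rewrite lerNl !le_max; have := ler_norm t2; have := ler_norm (- t1).
    rewrite normrN => h3 h4; apply/andP; split; apply/orP; [left|right].
      by apply: le_trans h3; rewrite lerN2.
    exact: le_trans h4.
  have step1 := @distribution_functionB_le R (variation_measure hbal) t1 t2
    (fun A M mA AM => variation_measure_disc_ltoo hbal mA AM) t12.
  have step2 := balayage_variation_le nu_charge nu_blaschke mchord chordM.
  apply: (le_trans step1); apply: (le_trans step2).
  (* The sweep integrates over the open upper half-plane only, and the chord lies in both closed
     half-planes; hence |nu| may be replaced by its restriction. *)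
  have -> : sweep (variation_measure nu_charge) chord =
      (sweep_up (variation_measure (charge_restr_charge mC nu_charge)) chord +
       variation_measure (charge_restr_charge mC nu_charge) chord)%E.
    rewrite sweepE; congr (_ + _)%E.
      apply: eq_measure_integral => A mA AU; rewrite [RHS]mE setIidl //.
      by move=> z /AU; exact: ltW.
    rewrite [RHS]mE; congr (charge_total_variation nu _).
    by apply/seteqP; split => z [[x xI <-] _]; split; [exists x| |exists x|];
      rewrite /closed_lower_half_plane /closed_upper_half_plane /=.
  have := sweep_chord_le t12 a0 a1
    (variation_measure (charge_restr_charge mC nu_charge)).
  move/le_trans; apply.
  do 3 apply: leeD => //.
  (* The mass of the two end points is nonnegative, so adding it only enlarges the bound. *)
  rewrite leeDl //.
  exact: (measure_ge0 (variation_measure (charge_restr_charge mC nu_charge))).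
Qed.
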